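(* Let $(\Omega,\mathcal F,P)$ be an atomless probability space and let $X,Y\in\mathcal L_1(\Omega,\mathcal F,P)$ with $X\notin A_2(Y)$. Let $h(p)=F_Y^{(-1)}(p)-F_X^{(-1)}(p)$ for $p\in(0,1)$ and $l(p)=F_Y^{(-2)}(p)-F_X^{(-2)}(p)$ for $p\in[0,1]$, and assume that the function $p\mapsto\operatorname{sign}(h(p))\in\{-1,0,1\}$ has at most finitely many discontinuity points. Let $$A=\{p\in(0,1]: l(q)<l(p)\ \text{ for all } q\in[0,p)\},\qquad A^C=[0,1]\setminus A,$$ and, for $p\in(0,1)$, $$Q(p)=\begin{cases}F_Y^{(-1)}(p),&p\in A,\\ F_X^{(-1)}(p),&p\in A^C,\end{cases}\qquad \hat Q(p)=\lim_{\varepsilon\downarrow0}Q(p-\varepsilon).$$ Let $\hat Z=\hat Q(U)$, where $U$ is a random variable on $(\Omega,\mathcal F,P)$ uniformly distributed on $[0,1]$. Then $\hat Z$ is a projection of $X$ onto $A_2(Y)$, i.e. $\hat Z\in A_2(Y)$ and $W_1(X,\hat Z)=\operatorname{dist}(X,A_2(Y))$. Furthermore, $$\operatorname{dist}(X,A_2(Y))=W_1(X,\hat Z)=\sup_{p\in[0,1]}\big(F_Y^{(-2)}(p)-F_X^{(-2)}(p)\big)=\sup_{\eta\in\mathbb R}\big(F_X^{(2)}(\eta)-F_Y^{(2)}(\eta)\big).$$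
   Context: $\mathcal L_1(\Omega,\mathcal F,P)$ is the space of integrable real random variables. For a random variable $Z$: $F_Z(\eta)=P(Z\le\eta)$; $F_Z^{(-1)}(p)=\inf\{\eta: F_Z(\eta)\ge p\}$ for $p\in(0,1)$; for integrable $Z$, $F_Z^{(2)}(\eta)=\int_{-\infty}^\eta F_Z(t)\,dt=\mathbb E[\max(\eta-Z,0)]$ for $\eta\in\mathbb R$; $F_Z^{(-2)}(p)=\int_0^pF_Z^{(-1)}(t)\,dt$ for $0<p\le1$ and $F_Z^{(-2)}(0)=0$. Second-order stochastic dominance: $Z\succeq_{(2)}Y$ iff $F_Z^{(2)}(\eta)\le F_Y^{(2)}(\eta)$ for all $\eta\in\mathbb R$ (equivalently $F_Z^{(-2)}(p)\ge F_Y^{(-2)}(p)$ for all $p\in[0,1]$). $A_2(Y)=\{Z\in\mathcal L_1(\Omega,\mathcal F,P): Z\succeq_{(2)}Y\}$. $W_1(X,Z)=\int_0^1|F_Z^{(-1)}(p)-F_X^{(-1)}(p)|\,dp$ and $\operatorname{dist}(X,A_2(Y))=\inf\{W_1(X,Z): Z\in A_2(Y)\}$. *)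

(* Defs.v *)
From HB Require Import structures.
From mathcomp Require Import all_boot all_order all_algebra.
From mathcomp Require Import all_classical all_reals all_analysis.
Import Order.TTheory GRing.Theory Num.Theory.
Import numFieldNormedType.Exports.

Set Implicit Arguments.
Unset Strict Implicit.
Unset Printing Implicit Defensive.

Local Open Scope classical_set_scope.
Local Open Scope ring_scope.

Definition atomless (d : measure_display) (T : measurableType d) (R : realType)
    (P : probability T R) : Prop :=
  forall A : set T, measurable A -> (0 < P A)%E ->
    exists B : set T, [/\ measurable B, B `<=` A, (0 < P B)%E & (P B < P A)%E].

(* Meaningful for 0 < p < 1 only: otherwise the set may be empty or unbounded
   below, and the real-valued [inf] then returns the junk value 0. *)
Definition quantile (d : measure_display) (T : measurableType d) (R : realType)
    (P : probability T R) (Z : {RV P >-> R}) (p : R) : R :=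
  inf [set eta : R | (p%:E <= cdf Z eta)%E].

Definition int_cdf (d : measure_display) (T : measurableType d) (R : realType)
    (P : probability T R) (Z : {RV P >-> R}) (eta : R) : \bar R :=
  (\int[lebesgue_measure]_(t in `]-oo, eta]) cdf Z t)%E.

(* The value at p = 0 is 0, the domain of integration being empty. *)
Definition int_quantile (d : measure_display) (T : measurableType d)
    (R : realType) (P : probability T R) (Z : {RV P >-> R}) (p : R) : \bar R :=
  (\int[lebesgue_measure]_(t in `]0%R, p[) (quantile Z t)%:E)%E.

Definition ssd (d : measure_display) (T : measurableType d) (R : realType)
    (P : probability T R) (Z Y : {RV P >-> R}) : Prop :=
  forall eta : R, (int_cdf Z eta <= int_cdf Y eta)%E.

Definition A2 (d : measure_display) (T : measurableType d) (R : realType)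
    (P : probability T R) (Y : {RV P >-> R}) : set {RV P >-> R} :=
  [set Z : {RV P >-> R} | (Z : T -> R) \in Lfun P 1%E /\ ssd Z Y].

Definition W1 (d : measure_display) (T : measurableType d) (R : realType)
    (P : probability T R) (X Z : {RV P >-> R}) : \bar R :=
  (\int[lebesgue_measure]_(p in `]0%R, 1%R[)
     (`|quantile Z p - quantile X p|%R)%:E)%E.

Definition dist_W1 (d : measure_display) (T : measurableType d) (R : realType)
    (P : probability T R) (X : {RV P >-> R}) (S : set {RV P >-> R}) : \bar R :=
  ereal_inf [set W1 X Z | Z in S].

Definition quantile_gap (d : measure_display) (T : measurableType d)
    (R : realType) (P : probability T R) (X Y : {RV P >-> R}) (p : R) : R :=
  quantile Y p - quantile X p.

Definition int_quantile_gap (d : measure_display) (T : measurableType d)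
    (R : realType) (P : probability T R) (X Y : {RV P >-> R}) (p : R) : \bar R :=
  (int_quantile Y p - int_quantile X p)%E.

Definition record_set (d : measure_display) (T : measurableType d)
    (R : realType) (P : probability T R) (X Y : {RV P >-> R}) : set R :=
  [set p : R | 0 < p <= 1 /\
    forall q : R, 0 <= q < p ->
      (int_quantile_gap X Y q < int_quantile_gap X Y p)%E].

Definition spliced_quantile (d : measure_display) (T : measurableType d)
    (R : realType) (P : probability T R) (X Y : {RV P >-> R}) (p : R) : R :=
  if p \in record_set X Y then quantile Y p else quantile X p.

(* The left limit is only considered on ]0, 1[; the value 0 elsewhere is an
   arbitrary choice, immaterial for the law of [proj_quantile X Y \o U] when U
   is uniform on [0, 1]. *)
Definition proj_quantile (d : measure_display) (T : measurableType d)
    (R : realType) (P : probability T R) (X Y : {RV P >-> R}) (p : R) : R :=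
  if 0 < p < 1 then
    lim (spliced_quantile X Y (p - eps) @[eps --> (0 : R)^'+])
  else 0.

Definition uniform01 (d : measure_display) (T : measurableType d)
    (R : realType) (P : probability T R) (U : {RV P >-> R}) : Prop :=
  forall B : set R, measurable B ->
    distribution P U B = uniform_prob (@ltr01 R) B.

(* Main.v *)
(** Write [f], [g] for the quantile functions of [X], [Y], let [l] be the primitive
of [g - f], and let [Q] be [g] where the points just to the left are records of
[l] and [f] elsewhere.  Since [sign (g - f)] has finitely many jumps, near any
point [l] is on either side strictly increasing or nonincreasing, so being a
record is locally constant on either side; hence the left limit of the spliced
quantile exists and equals [Q].  At a switch between [f] and [g] the two
functions cross in the right direction, so [Q] is nondecreasing and
left-continuous, thus the quantile function of [Q(U)].  Moreover [Q >= f], and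
the primitive [G] of [Q - f] is the running maximum of [l], by induction along
[0, 1].  Therefore [G >= l], i.e. [Q(U)] dominates [Y], and
[W1(X, Q(U)) = G(1) = sup l], while any [Z] dominating [Y] has
[W1(X, Z) >= sup l] because its integrated quantile is above that of [Y].

Integrated distribution functions and integrated quantiles are convex conjugate:
by Tonelli, [int_cdf Z eta] is the integral of [max (eta - q, 0)] over ]0, 1[,
where [q] is the quantile function of [Z]; Young's inequality bounds it below by
[p * eta - \int_0^p q], with equality as soon as [q] crosses [eta] at [p].  This
translates dominance, and both suprema, from one side to the other.

A uniform variable exists on an atomless space because a maximal chain of events
with strictly increasing probabilities takes every probability in ]0, 1[; its
members are the sublevel sets of the variable. *)

Require Import Defs.
From HB Require Import structures.
From mathcomp Require Import all_boot all_order all_algebra.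
From mathcomp Require Import all_classical all_reals all_analysis.
From mathcomp Require Import measurable_realfun lra.
Import Order.TTheory GRing.Theory Num.Theory.
Import numFieldNormedType.Exports.

Set Implicit Arguments.
Unset Strict Implicit.
Unset Printing Implicit Defensive.

Local Open Scope classical_set_scope.
Local Open Scope ring_scope.

(** * Uniform variables on atomless spaces *)

(** Open right half-lines are stable under intersection and generate the Borel sets. Each is the
    complement of a closed left half-line, and the total mass is 1, so the hypothesis determines its
    measure. *)
Lemma probability_eq_of_itvNyc (R : realType)
    (m1 m2 : probability R R) :
  (forall t : R, m1 `]-oo, t]%classic = m2 `]-oo, t]%classic) ->
  forall B : set R, measurable B -> m1 B = m2 B.
Proof.
move=> h B mB.
apply: (@measure_unique _ R R (@RGenOInfty.G R)
  (fun n => `]- n%:R, +oo[%classic)) => //.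
- exact: RGenOInfty.measurableE.
- move=> _ _ [x ->] [y ->]; exists (Num.max x y).
  by apply/seteqP; split=> z /=; rewrite !in_itv/= !andbT gt_max => /andP.
- by move=> n; exists (- n%:R).
- apply/seteqP; split=> // x _; exists (Num.truncn (- x)).+1 => //=.
  by rewrite in_itv/= andbT ltrNl truncnS_gt.
- move=> _ [x ->]; have E (m : probability R R) :
      m `]x, +oo[%classic = (1 - m `]-oo, x]%classic)%E.
    by rewrite -probability_setC// setCitvl.
  by have := E m1; rewrite h -E.
- by move=> k; rewrite (le_lt_trans (probability_le1 _ _)) ?ltry.
Qed.

Lemma uniform_probE (R : realType) (B : set R) : measurable B ->
  uniform_prob (@ltr01 R) B = lebesgue_measure (B `&` `[0, 1]).
Proof.
move=> mB; rewrite /uniform_prob integral_uniform_pdf.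
rewrite (eq_integral (cst 1%E)) => [|x]; last first.
  by rewrite inE/= in_itv/= /uniform_pdf => -[_ ->]; rewrite subr0 invr1.
by rewrite integral_cst ?mul1e//; exact: measurableI.
Qed.

Lemma probability_eq_of_cdf01 (R : realType)
    (m1 m2 : probability R R) :
  (forall t : R, 0 < t < 1 -> m1 `]-oo, t]%classic = t%:E) ->
  (forall t : R, 0 < t < 1 -> m2 `]-oo, t]%classic = t%:E) ->
  forall B : set R, measurable B -> m1 B = m2 B.
Proof.
move=> h1 h2.
have le_m (m : probability R R) (s t : R) : s <= t ->
    (m `]-oo, s]%classic <= m `]-oo, t]%classic)%E.
  by move=> st; rewrite le_measure ?inE//; exact: subset_itvl.
have below (m : probability R R) :
    (forall t : R, 0 < t < 1 -> m `]-oo, t]%classic = t%:E) ->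
    forall t : R, t <= 0 -> m `]-oo, t]%classic = 0%E.
  move=> h t t0; apply/eqP; rewrite eq_le measure_ge0 andbT.
  apply/lee_addgt0Pr => e e0; rewrite add0e.
  (* The cap at 1/2 keeps the point inside ]0, 1[, where [h] applies, even for large [e]. *)
  have e1 : 0 < Num.min e 2^-1 < 1 by rewrite lt_min e0 gt_min; lra.
  rewrite (@le_trans _ _ (m `]-oo, Num.min e 2^-1]%classic))//.
    by apply: le_m; have /andP[/ltW] := e1; lra.
  by rewrite h// lee_fin ge_min lexx.
have above (m : probability R R) :
    (forall t : R, 0 < t < 1 -> m `]-oo, t]%classic = t%:E) ->
    forall t : R, 1 <= t -> m `]-oo, t]%classic = 1%E.
  move=> h t t1; apply/eqP; rewrite eq_le probability_le1//=.
  apply/lee_addgt0Pr => e e0; rewrite -leeBlDr// -EFinB.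
  have e1 : 0 < Num.max (1 - e) 2^-1 < 1 by rewrite lt_max gt_max; lra.
  rewrite (@le_trans _ _ (m `]-oo, Num.max (1 - e) 2^-1]%classic))//.
    by rewrite h// lee_fin le_max lexx.
  by apply: le_m; have /andP[_ /ltW] := e1; lra.
apply: probability_eq_of_itvNyc => t.
have [t0|t0] := leP t 0; first by rewrite !below.
have [t1|t1] := leP 1 t; first by rewrite !above.
by rewrite h1 ?h2 ?t0.
Qed.

Section uniform_variable.
Context (R : realType) (d : measure_display) (T : measurableType d)
  (P : probability T R).
Implicit Types (C : set (set T)) (A B E : set T).

Definition mass A : R := fine (P A).

Let massE A : measurable A -> P A = (mass A)%:E.
Proof. by move=> mA; rewrite fineK// fin_num_measure. Qed.

Let measure_le A B : measurable A -> measurable B -> A `<=` B -> (P A <= P B)%E.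
Proof. by move=> mA mB AB; rewrite le_measure// inE. Qed.

Let mass_le A B : measurable A -> measurable B -> A `<=` B -> mass A <= mass B.
Proof. by move=> mA mB AB; rewrite -lee_fin -!massE//; exact: measure_le. Qed.

Let massC A : measurable A -> mass (~` A) = 1 - mass A.
Proof. by move=> mA; rewrite /mass probability_setC// massE. Qed.

Definition strictly_below A B := A `<=` B /\ mass A < mass B.

(* Strictness makes each probability be taken by at most one member of a chain,
   so that sets differing by a null set cannot obstruct maximality. *)
Definition mass_comparable A B :=
  [\/ A = B, strictly_below A B | strictly_below B A].

Definition strict_chain C := (forall A, C A -> measurable A) /\
  (forall A B, C A -> C B -> mass_comparable A B).

(** Maximality in the form used below: a set enters the chain as soon as it has been compared with
    every member. *)
Definition saturated C := strict_chain C /\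
  forall D, measurable D -> (forall A, C A -> mass_comparable D A) -> C D.

Let mass_comparableC A B : mass_comparable A B -> mass_comparable B A.
Proof. by case; [constructor 1|constructor 3|constructor 2]. Qed.

Lemma saturated_chain_exists : exists C, saturated C.
Proof.
have [|C [hC Cmax]] := @Zorn_bigcup _ strict_chain.
  move=> F FC Ftot; split=> [A [X FX XA]|A B [X FX XA] [Y FY YB]].
    exact: (FC _ FX).1.
  have [XY|YX] := Ftot _ _ FX FY.
    by apply: (FC _ FY).2 => //; exact: XY.
  by apply: (FC _ FX).2 => //; exact: YX.
exists C; split=> // D mD hD; apply: contrapT => nCD.
apply: (Cmax (C `|` [set D])).
  by split=> [A CA|sub]; [left|apply: nCD; apply: sub; right].
split=> [A [/hC.1//|-> //]|A B [CA|->] [CB|->]].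
- exact: hC.2.
- exact/mass_comparableC/hD.
- exact: hD.
- by constructor 1.
Qed.

(** Complementation reverses strict inclusion. This turns facts about members below a level into
    facts about members above the complementary level. *)
Lemma saturatedC C : saturated C -> saturated [set ~` A | A in C].
Proof.
have cmpC A B : measurable A -> measurable B ->
    mass_comparable A B -> mass_comparable (~` A) (~` B).
  move=> mA mB [->|[AB PAB]|[AB PAB]]; first by constructor 1.
  - by constructor 3; split; [exact: subsetC|rewrite !massC//; lra].
  - by constructor 2; split; [exact: subsetC|rewrite !massC//; lra].
move=> [[mC hC] Cmax]; split; first split.
- by move=> _ [A /mC mA <-]; exact: measurableC.
- by move=> _ _ [A CA <-] [B CB <-]; apply: cmpC; [exact: mC|exact: mC|exact: hC].
- move=> D mD hD; exists (~` D); last by rewrite setCK.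
  apply: Cmax => [|A CA]; first exact: measurableC.
  rewrite -[A]setCK; apply: cmpC => //; first by apply/measurableC/mC.
  by apply: hD; exists A.
Qed.

(** Take members whose probabilities approach the supremum [a] of those below [c]. If [a] is not
    attained, their union is comparable with every member, hence belongs to the chain, and is itself
    the desired largest member. *)
Lemma saturated_below_max C (c : R) : saturated C -> 0 < c ->
  (forall A, C A -> mass A != c) ->
  exists A, [/\ C A, mass A < c & forall E, C E -> mass E < c -> E `<=` A].
Proof.
move=> [[mC hC] Cmax] c0 nc.
have incl A E : C A -> C E -> mass A <= mass E -> A `<=` E.
  move=> CA CE AE; have [->|[]//|[_ EA]] := hC _ _ CA CE; first exact.
  by exfalso; lra.
pose L := [set A | C A /\ mass A < c].
(* Otherwise every member has probability above [c], so [set0] is strictly below all of them and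
   belongs to the chain, with probability 0. *)
have [A0 L0] : L !=set0.
  apply: contrapT => /set0P/negP; rewrite negbK => /eqP L0.
  have cC A : C A -> c < mass A.
    move=> CA; rewrite lt_neqAle eq_sym nc//= leNgt; apply/negP => pAc.
    by have : L A by []; rewrite L0.
  have C0 : C set0.
    apply: Cmax => // A CA; constructor 2; split=> //.
    by rewrite {1}/mass measure0/=; apply: (lt_trans c0); exact: cC.
  by have := cC _ C0; rewrite /mass measure0/=; lra.
pose a := sup [set mass A | A in L].
have supL : has_sup [set mass A | A in L].
  by split; [exists (mass A0), A0|exists c => _ [A [_ /ltW ?] <-]].
have ac : a <= c by apply: ge_sup => [|_ [A [_ /ltW ?] <-]//]; exact: supL.1.
have pa A : L A -> mass A <= a.
  by move=> LA; apply: sup_upper_bound => //; exists A.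
apply: contrapT => nomax.
have {}pa A : L A -> mass A < a.
  move=> LA; rewrite lt_neqAle pa// andbT; apply/eqP => pAa; apply: nomax.
  exists A; split; [exact: LA.1|exact: LA.2|move=> E CE Ec].
  by apply: incl => //; [exact: LA.1|rewrite pAa pa].
have /choice[E hE] n : exists E, L E /\ a - n.+1%:R^-1 < mass E.
  have [|_ [E LE <-] aE] := @sup_adherent _ _ n.+1%:R^-1 _ supL; first by [].
  by exists E.
have approx A : L A -> exists n, mass A < mass (E n).
  move=> /pa pAa; pose n := Num.truncn (a - mass A)^-1; exists n.
  apply: (lt_trans _ (hE n).2); rewrite ltrBrDr -ltrBrDl.
  by rewrite invf_plt ?posrE ?subr_gt0// truncnS_gt.
pose S := \bigcup_n E n.
have mE n : measurable (E n) by apply: mC; exact: (hE n).1.1.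
have mS : measurable S by exact: bigcup_measurable.
(* By nesting, a finite union of members of [L] is one of them. Continuity from below then bounds
   the probability of [S] by [a]. *)
have LF n : L (\big[setU/set0]_(i < n.+1) E i).
  elim: n => [|n IH]; first by rewrite big_ord1; exact: (hE 0).1.
  rewrite big_ord_recr/=; have LE := (hE n.+1).1.
  have [h|/ltW h] :=
      leP (mass (\big[setU/set0]_(i < n.+1) E i)) (mass (E n.+1)).
    by move/setUidPr: (incl _ _ IH.1 LE.1 h) => ->.
  by move/setUidPl: (incl _ _ LE.1 IH.1 h) => ->.
have Sa : mass S <= a.
  rewrite -lee_fin -massE//.
  have := @nondecreasing_cvg_mu _ _ _ P
    (fun n => \big[setU/set0]_(i < n.+1) E i).
  rewrite bigcup_bigsetU_bigcup => /(_ _ mS) h.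
  have mF n : measurable (\big[setU/set0]_(i < n.+1) E i).
    by apply: mC; exact: (LF n).1.
  apply: (cvge_to_le (h mF _)) => [m n mn|].
    by apply/subsetPset; exact: subset_bigsetU.
  apply: nearW => n; rewrite /= massE; last exact: mF.
  by rewrite lee_fin; exact: ltW (pa _ (LF n)).
have subS A : L A -> A `<=` S /\ mass A < mass S.
  move=> LA; have [n An] := approx _ LA; split.
    apply: (subset_trans (incl _ _ LA.1 (hE n).1.1 (ltW An))).
    exact: bigcup_sup.
  by apply: (lt_le_trans An); apply: mass_le => //; exact: bigcup_sup.
have CS : C S.
  apply: Cmax => // A CA; have [Ac|cA] := ltP (mass A) c.
    by constructor 3; exact: subS.
  have {}cA : c < mass A by rewrite lt_neqAle eq_sym nc.
  constructor 2; split; last lra.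
  apply: bigcup_sub => n _; apply: incl => //; first exact: (hE n).1.1.
  by have := (hE n).1.2; lra.
have LS : L S by split=> //; rewrite lt_neqAle nc//=; exact: le_trans ac.
apply: nomax; exists S; split=> //; first exact: LS.2.
by move=> A CA Ac; exact: (subS A _).1.
Qed.

Lemma saturated_above_min C (c : R) : saturated C -> c < 1 ->
  (forall A, C A -> mass A != c) ->
  exists A, [/\ C A, c < mass A & forall E, C E -> c < mass E -> A `<=` E].
Proof.
move=> sC c1 nc; have mC := sC.1.1.
have [||_ [[A CA <-] Ac hA]] :=
    @saturated_below_max _ (1 - c) (saturatedC sC).
- by rewrite subr_gt0.
- move=> _ [A CA <-]; rewrite massC; last exact: mC.
  by rewrite (inj_eq (addrI _)) eqr_opp nc.
exists A; split=> //; first by move: Ac; rewrite massC; [lra|exact: mC].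
move=> E CE cE; rewrite -[A]setCK -[E]setCK; apply: subsetC.
by apply: hA; [exists E|rewrite massC; [lra|exact: mC]].
Qed.

(** If [c] were skipped, let [A] be the largest member below it and [B] the smallest above it.
    Atomlessness yields a part [D] of the difference with intermediate probability. Then [A] united
    with [D] is comparable with every member, so it lies in the chain strictly between [A] and [B],
    which is impossible. *)
Lemma saturated_measure_onto C (c : R) : atomless P -> saturated C ->
  0 < c < 1 -> exists2 A, C A & P A = c%:E.
Proof.
move=> aP sC /andP[c0 c1]; have [[mC hC] Cmax] := sC.
suff [A CA pA] : exists2 A, C A & mass A = c.
  by exists A => //; rewrite massE ?pA//; exact: mC.
apply: contrapT => nc.
have {}nc A : C A -> mass A != c.
  by move=> CA; apply/eqP => pA; apply: nc; exists A.
have [A [CA Ac hA]] := saturated_below_max sC c0 nc.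
have [B [CB cB hB]] := saturated_above_min sC c1 nc.
have [mA mB] := (mC _ CA, mC _ CB).
have AB : A `<=` B.
  by have [->|[]//|[_ BA]] := hC _ _ CA CB; [exact: subset_refl|exfalso; lra].
have mBA : measurable (B `\` A) by exact: measurableD.
have pU D : measurable D -> D `<=` B `\` A -> mass (A `|` D) = mass A + mass D.
  move=> mD DBA; apply: EFin_inj; rewrite EFinD -!massE//; last exact: measurableU.
  rewrite measureU//; apply/seteqP; split=> // w [Aw /DBA[]//].
have pB : mass B = mass A + mass (B `\` A).
  by rewrite -pU// setDUK.
have [|D [mD DBA]] := aP _ mBA; first by rewrite massE// lte_fin; lra.
rewrite !massE// !lte_fin => D0 DB.
have mAD : measurable (A `|` D) by exact: measurableU.
have pAD := pU _ mD DBA.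
have CAD : C (A `|` D).
  apply: Cmax => // E CE; have [Ec|cE] := ltP (mass E) c.
    constructor 3; have EA := hA _ CE Ec; split; first by move=> w /EA; left.
    by have := mass_le (mC _ CE) mA EA; lra.
  have {}cE : c < mass E by rewrite lt_neqAle eq_sym nc.
  have BE := hB _ CE cE; constructor 2; split.
    by move=> w [/AB|/DBA[]] ? *; exact: BE.
  by have := mass_le mB (mC _ CE) BE; lra.
have [ADc|cAD] := ltP (mass (A `|` D)) c.
  by have := mass_le mAD mA (hA _ CAD ADc); lra.
have {}cAD : c < mass (A `|` D) by rewrite lt_neqAle eq_sym nc.
by have := mass_le mB mAD (hB _ CAD cAD); lra.
Qed.

(** [U w] is the infimum of the levels [t] with [w] in [A t]. The event that [U] is at most [t]
    contains [A t] and lies in [A (t + e)] for all small positive [e], so it has probability [t]. *)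
Lemma uniform01_exists : atomless P -> exists U : {RV P >-> R}, uniform01 U.
Proof.
move=> aP; have [C sC] := saturated_chain_exists.
have /choice[A hA] t : exists A, 0 < t < 1 -> C A /\ P A = t%:E.
  have [t01|_] := boolP (0 < t < 1); last by exists set0.
  by have [A CA PA] := saturated_measure_onto aP sC t01; exists A.
have mA t : 0 < t < 1 -> measurable (A t).
  by move=> /hA[CA _]; exact: sC.1.1.
have subA s t : 0 < s -> s < t -> t < 1 -> A s `<=` A t.
  move=> s0 st t1.
  have [|CAs PAs] := hA s; first by rewrite s0/=; lra.
  have [|CAt PAt] := hA t; first by apply/andP; split=> //; lra.
  have [->//|[]//|[_]] := sC.1.2 _ _ CAs CAt.
  by rewrite /mass PAs PAt/= => ts; exfalso; lra.
(* The level 1 makes the set non-empty for points that lie in no [A t]. *)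
pose S w := [set t | t = 1 \/ (0 < t < 1 /\ A t w)].
pose U w := inf (S w).
have infS w : has_inf (S w).
  split; first by exists 1; left.
  by exists 0 => t [->|[/andP[/ltW]]].
have Ule w t : 0 < t < 1 -> A t w -> U w <= t.
  by move=> t01 Atw; apply: ge_inf; [exact: (infS w).2|right].
have Ult w t : t <= 1 -> U w < t -> exists s, [/\ 0 < s < 1, s < t & A s w].
  move=> t1 /(inf_lt (infS w).1)[s [->|[s01 As]] st]; first by exfalso; lra.
  by exists s.
have U0 w : 0 <= U w.
  by apply: lb_le_inf; [exact: (infS w).1|move=> t [->|[/andP[/ltW]]]].
have U1 w : U w <= 1 by apply: ge_inf; [exact: (infS w).2|left].
have mU : measurable_fun setT U.
  apply: (measurability _ (RGenInftyO.measurableE R)) => //.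
  move=> _ [_ [t ->] <-]; rewrite setTI.
  have [t0|t0] := leP t 0.
    rewrite (_ : _ @^-1` _ = set0)//; apply/seteqP; split=> // w /=.
    by rewrite in_itv/= => /lt_le_trans/(_ t0); rewrite ltNge U0.
  have [t1|t1] := ltP 1 t.
    rewrite (_ : _ @^-1` _ = setT)//; apply/seteqP; split=> // w _ /=.
    by rewrite in_itv/=; exact: le_lt_trans t1.
  (* These levels increase to [t], which writes the event [U < t] as a countable union; with [n.+2]
     already [s 0] is positive. *)
  pose s n : R := t - t / n.+2%:R.
  have s_t n : 0 < s n < t.
    rewrite /s subr_gt0 gtrBl divr_gt0// andbT.
    by rewrite gtr_pMr// invf_lt1// ltr1n.
  rewrite (_ : _ @^-1` _ = \bigcup_n A (s n)).
    apply: bigcup_measurable => n _; apply: mA.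
    by have /andP[-> /lt_le_trans ->] := s_t n.
  apply/seteqP; split=> w /=; rewrite in_itv/=.
    move=> /(Ult _ _ t1)[r [/andP[r0 r1] rt Ar]].
    pose n := Num.truncn (t / (t - r)).
    exists n => //; apply: (subA r) => //; last first.
      by have /andP[_ /lt_le_trans ->] := s_t n.
    rewrite /s ltrBrDr -ltrBrDl ltr_pdivrMr// mulrC -ltr_pdivrMr ?subr_gt0//.
    by rewrite (lt_trans (truncnS_gt _))// ltr_nat.
  move=> [n _ Asw]; have /andP[sn0 snt] := s_t n.
  by apply: le_lt_trans (snt); apply: Ule => //; rewrite sn0 (lt_le_trans snt).
pose V : {RV P >-> R} := HB.pack U (isMeasurableFun.Build _ _ _ _ _ mU).
exists V => B mB.
(* The uniform law lives on [measurableTypeR R]; its image under the identity is a probability on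
   [R], as the comparison of laws requires. *)
pose id_mfun : {mfun measurableTypeR R >-> R} :=
  HB.pack (idfun : measurableTypeR R -> R)
    (@isMeasurableFun.Build _ _ (measurableTypeR R) R idfun
      (@measurable_id _ (measurableTypeR R) setT)).
pose W := distribution (uniform_prob (@ltr01 R)) id_mfun.
change (uniform_prob (@ltr01 R) B) with (W B).
apply: probability_eq_of_cdf01 mB => t /andP[t0 t1]; last first.
  change (uniform_prob (@ltr01 R) `]-oo, t]%classic = t%:E).
  rewrite uniform_probE//.
  rewrite (_ : `]-oo, t] `&` `[0, 1] = `[0, t]%classic).
    by rewrite lebesgue_measure_itv/= lte_fin t0 oppr0 adde0.
  apply/seteqP; split=> x /=; rewrite !in_itv/=; first by move=> [? /andP[->]].
  by move=> /andP[-> xt]; rewrite xt (le_trans xt (ltW t1)).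
have mV r : measurable (V @^-1` `]-oo, r]) by exact: measurable_funPTI.
rewrite /distribution /pushforward.
apply/eqP; rewrite eq_le; apply/andP; split.
  apply/lee_addgt0Pr => e e0; rewrite -EFinD.
  have [te|te] := ltP (t + e) 1; last first.
    by rewrite (le_trans (probability_le1 _ (mV t)))// lee_fin.
  have te01 : 0 < t + e < 1 by rewrite te andbT addr_gt0.
  rewrite -(hA _ te01).2.
  apply: measure_le; [exact: mV|exact: mA|].
  move=> w /=; rewrite in_itv/= => Uwt.
  have [||s [/andP[s0 s1] ste]] := Ult w (t + e); first exact: ltW.
    by rewrite (le_lt_trans Uwt)// ltrDl.
  exact: subA.
have t01 : 0 < t < 1 by rewrite t0.
rewrite -(hA _ t01).2.
apply: measure_le; [exact: mA|exact: mV|].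
by move=> w Atw; rewrite /= in_itv/=; exact: Ule.
Qed.

End uniform_variable.

(** * Primitives and records on the unit interval *)

Section unit_continuity.
Context (R : realType).
Implicit Types (u v : R -> R).

(** Uniform continuity on [0, 1] in elementary form: nothing is asked of [u] outside the unit
    interval. *)
Definition unit_ucont u := forall e, 0 < e -> exists2 del, 0 < del &
  forall x y, 0 <= x -> x <= y -> y <= 1 -> y - x < del -> `|u y - u x| < e.

Lemma unit_ucont_cst (c : R) : unit_ucont (fun=> c).
Proof. by move=> e e0; exists 1 => // *; rewrite subrr normr0. Qed.

Lemma unit_ucont_le_left u v (a s : R) : unit_ucont u -> unit_ucont v ->
  0 <= a < s -> s <= 1 -> (forall r, a < r < s -> u r <= v r) -> u s <= v s.
Proof.
move=> cu cv /andP[a0 as_] s1 uv; apply/ler_addgt0Pr => e e0.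
have e2 : 0 < e / 2 by lra.
have [du du0 hu] := cu _ e2; have [dv dv0 hv] := cv _ e2.
(* A point of ]a, s[ close enough to [s] for both moduli of continuity. *)
pose r := Num.max ((a + s) / 2) (s - Num.min du dv / 2).
have m0 : 0 < Num.min du dv by rewrite lt_min du0.
have r1 : a < r < s by rewrite lt_max gt_max; lra.
have m1 : Num.min du dv <= du by rewrite ge_min lexx.
have m2 : Num.min du dv <= dv by rewrite ge_min lexx orbT.
have r2 : s - Num.min du dv / 2 <= r by rewrite le_max lexx orbT.
have := uv _ r1; move: r1 => /andP[ar rs] uvr.
have /ltr_normlW := hu r s ltac:(lra) ltac:(lra) ltac:(lra) ltac:(lra).
have := hv r s ltac:(lra) ltac:(lra) ltac:(lra) ltac:(lra).
by rewrite ltr_norml => /andP[]; lra.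
Qed.

Lemma unit_ucont_le_right u v (s b : R) : unit_ucont u -> unit_ucont v ->
  0 <= s -> s < b <= 1 -> (forall r, s < r < b -> u r <= v r) -> u s <= v s.
Proof.
move=> cu cv s0 /andP[sb b1] uv; apply/ler_addgt0Pr => e e0.
have e2 : 0 < e / 2 by lra.
have [du du0 hu] := cu _ e2; have [dv dv0 hv] := cv _ e2.
pose r := Num.min ((s + b) / 2) (s + Num.min du dv / 2).
have m0 : 0 < Num.min du dv by rewrite lt_min du0.
have r1 : s < r < b by rewrite lt_min gt_min; lra.
have m1 : Num.min du dv <= du by rewrite ge_min lexx.
have m2 : Num.min du dv <= dv by rewrite ge_min lexx orbT.
have r2 : r <= s + Num.min du dv / 2 by rewrite ge_min lexx orbT.
have := uv _ r1; move: r1 => /andP[sr rb] uvr.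
have := hu s r ltac:(lra) ltac:(lra) ltac:(lra) ltac:(lra).
have /ltr_normlW := hv s r ltac:(lra) ltac:(lra) ltac:(lra) ltac:(lra).
by rewrite ltr_norml => ? /andP[]; lra.
Qed.

(** Let [s] be the supremum of the points up to which [K] holds throughout. The left-hand step gives
    [K s], and the right-hand step rules out [s < 1]. *)
Lemma unit_interval_real_induction (K : R -> Prop) : K 0 ->
  (forall s, 0 <= s < 1 -> (forall r, 0 <= r <= s -> K r) ->
    exists2 b, s < b & forall r, s < r < b -> K r) ->
  (forall s, 0 < s <= 1 -> (forall r, 0 <= r < s -> K r) -> K s) ->
  forall s, 0 <= s <= 1 -> K s.
Proof.
move=> K0 Kright Kleft.
pose S := [set s : R | 0 <= s <= 1 /\ forall r, 0 <= r <= s -> K r].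
have S0 : S 0.
  split=> [|r /andP[r0 r1]]; first by rewrite lexx ler01.
  by rewrite (_ : r = 0)//; apply/eqP; rewrite eq_le r0 r1.
have supS : has_sup S by split; [exists 0|exists 1 => s [/andP[]]].
pose s := sup S.
have s0 : 0 <= s by exact: sup_upper_bound.
have s1 : s <= 1 by apply: ge_sup => [|r [/andP[]//]]; exists 0.
have Kbelow r : 0 <= r < s -> K r.
  move=> /andP[r0 rs].
  have [t [_ Kt] rt] := sup_gt supS.1 rs.
  by apply: Kt; rewrite r0 ltW.
have Ks : K s.
  have [->//|sn0] := eqVneq s 0.
  by apply: Kleft => //; rewrite s1 lt_neqAle eq_sym sn0 s0.
have Kle r : 0 <= r <= s -> K r.
  move=> /andP[r0]; rewrite le_eqVlt => /predU1P[->//|rs].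
  by apply: Kbelow; rewrite r0.
suff s_1 : s = 1 by move=> r; rewrite -s_1; exact: Kle.
apply/eqP; rewrite eq_le s1 leNgt; apply/negP => slt1.
have [|b sb Kb] := Kright s _ Kle; first by rewrite s0.
pose t := Num.min ((s + b) / 2) 1.
have tb : t < b by rewrite gt_min; apply/orP; left; lra.
have st : s < t by rewrite lt_min slt1 andbT; lra.
suff : S t by move=> /(sup_upper_bound supS); rewrite -/s leNgt st.
split=> [|r /andP[r0 rt]]; first by rewrite ge_min lexx orbT andbT; lra.
have [rs|sr] := leP r s; first by apply: Kle; rewrite r0.
by apply: Kb; rewrite sr/=; lra.
Qed.

End unit_continuity.

Section primitive.
Context (R : realType).
Implicit Types (phi psi : R -> R).
Local Notation mu := (@lebesgue_measure R).

Definition integrable01 phi := mu.-integrable `]0, 1[ (EFin \o phi).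

(** For [p <= 1] the open interval avoids 0 and 1, where quantiles take junk values. *)
Definition prim phi (p : R) : R := \int[mu]_(x in `]0, p[) phi x.

Lemma prim0 phi : prim phi 0 = 0.
Proof. by rewrite /prim set_itvoo0 Rintegral_set0. Qed.

Lemma integrable01S phi (a b : itv_bound R) : (BRight 0 <= a)%O ->
  (b <= BLeft 1)%O -> integrable01 phi ->
  mu.-integrable [set` Interval a b] (EFin \o phi).
Proof.
by move=> a0 b1; apply: integrableS => //; apply: subset_itv.
Qed.

Lemma primB phi psi p : p <= 1 -> integrable01 phi -> integrable01 psi ->
  prim (phi \- psi) p = prim phi p - prim psi p.
Proof.
by move=> p1 iphi ipsi; apply: RintegralB => //; apply: integrable01S => //.
Qed.

Lemma primE phi p : p <= 1 -> integrable01 phi ->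
  (\int[mu]_(x in `]0%R, p[) (phi x)%:E)%E = (prim phi p)%:E.
Proof.
move=> p1 iphi; rewrite fineK//; apply: integrable_fin_num => //.
by apply: integrable01S.
Qed.

Lemma prim_split phi (p q : R) : 0 <= p -> p <= q -> q <= 1 -> integrable01 phi ->
  prim phi q = prim phi p + \int[mu]_(x in `]p, q[) phi x.
Proof.
move=> p0; rewrite le_eqVlt => /predU1P[<-|pq] q1 iphi.
  by rewrite set_itvoo0 Rintegral_set0 addr0.
rewrite -(@Rintegral_itvB _ phi (BRight 0) (BLeft q) p)//; last first.
  exact: integrable01S.
rewrite -Rintegral_itv_bndo_bndc; first by rewrite addrC subrK.
by apply: integrable01S => //; rewrite bnd_simp; lra.
Qed.

Lemma prim_le phi (p q : R) : 0 <= p -> p <= q -> q <= 1 -> integrable01 phi ->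
  (forall x, p < x < q -> 0 <= phi x) -> prim phi p <= prim phi q.
Proof.
move=> p0 pq q1 iphi h; rewrite (@prim_split _ p q)// lerDl.
by apply: Rintegral_ge0 => x /=; rewrite in_itv/=; exact: h.
Qed.

Lemma prim_ge phi (p q : R) : 0 <= p -> p <= q -> q <= 1 -> integrable01 phi ->
  (forall x, p < x < q -> phi x <= 0) -> prim phi q <= prim phi p.
Proof.
move=> p0 pq q1 iphi h; rewrite (@prim_split _ p q)// gerDl.
have i0 : mu.-integrable `]p, q[ (EFin \o cst 0) by exact: integrable0.
have -> : 0 = \int[mu]_(x in `]p, q[) (cst 0 x : R).
  by rewrite Rintegral_cst ?mul0r.
by apply: le_Rintegral => //; exact: integrable01S.
Qed.

(** Equality would make the integral of the absolute value of [phi] over ]p, q[ zero, so [phi] would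
    vanish almost everywhere on an interval of positive length. *)
Lemma prim_lt phi (p q : R) : 0 <= p -> p < q -> q <= 1 -> integrable01 phi ->
  (forall x, p < x < q -> 0 < phi x) -> prim phi p < prim phi q.
Proof.
move=> p0 pq q1 iphi h; have pq' := ltW pq.
have ipq : mu.-integrable `]p, q[ (EFin \o phi) by exact: integrable01S.
rewrite lt_neqAle prim_le//; last by move=> x /h/ltW.
rewrite andbT (@prim_split _ p q)// -subr_eq0 opprD addrA subrr add0r oppr_eq0.
apply/negP => /eqP I0.
have /(ae_eq_integral_abs mu (measurable_itv _) (measurable_int _ ipq)) :
    (\int[mu]_(x in `]p, q[) `|(EFin \o phi) x| = 0)%E.
  rewrite -[RHS]/(0%R%:E) -I0 /Rintegral fineK; last exact: integrable_fin_num.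
  apply: eq_integral => x; rewrite inE/= in_itv/= => /h/ltW x0.
  by rewrite ger0_norm.
move=> [N [mN N0 hN]].
have : (mu `]p, q[ <= mu N)%E.
  apply: le_measure; rewrite ?inE// => x xpq; apply: hN => /= /(_ xpq).
  by move: xpq; rewrite /= in_itv/= => /h x0 [] x0'; rewrite x0' ltxx in x0.
by rewrite N0 lebesgue_measure_itv/= lte_fin pq -EFinB lee_fin leNgt subr_gt0 pq.
Qed.

Lemma prim_eq phi psi (p q : R) : 0 <= p -> p <= q -> q <= 1 ->
  integrable01 phi -> integrable01 psi ->
  (forall x, p < x < q -> phi x = psi x) ->
  prim phi q - prim phi p = prim psi q - prim psi p.
Proof.
move=> p0 pq q1 iphi ipsi h.
rewrite (@prim_split phi p q)// (@prim_split psi p q)//.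
rewrite ![prim _ p + _]addrC !addrK.
by apply: eq_Rintegral => x; rewrite inE/= in_itv/=; exact: h.
Qed.

Lemma prim_ucont phi : integrable01 phi -> unit_ucont (prim phi).
Proof.
move=> iphi e e0.
(* Absolute continuity of the integral, for [phi] extended by 0 to the whole line. *)
have /integral_normr_continuous/(_ _ e0)[del [del0 hdel]] :
    mu.-integrable setT (EFin \o (phi \_ `]0, 1[)).
  by rewrite -restrict_EFin; apply/integrable_restrict => //=; rewrite setTI.
exists del => // x y x0 xy y1 xydel.
rewrite (@prim_split _ x y)// addrC addKr.
have ixy : mu.-integrable `]x, y[ (EFin \o phi) by exact: integrable01S.
apply: (le_lt_trans (le_normr_Rintegral _ ixy)) => //.
have -> : \int[mu]_(t in `]x, y[) `|phi t| =
    \int[mu]_(t in `]x, y[) `|(phi \_ `]0, 1[) t|.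
  apply: eq_Rintegral => t; rewrite inE/= in_itv/= => /andP[xt ty].
  by rewrite patchE ifT// inE/= in_itv/=; lra.
have mxy : (mu `]x, y[ < del%:E)%E.
  by rewrite lebesgue_measure_itv/=; case: ifPn => _; rewrite -?EFinB lte_fin.
exact: hdel mxy.
Qed.

End primitive.

(** * Intervals of steady sign *)

Section sign_changes.
Context (R : realType).
Implicit Types (h : R -> R) (N : set R).

Definition sign_jumps h : set R := [set p | 0 < p < 1 /\
  ~ {for p, continuous (fun q => Num.sg (h q) : R)}].

(** Zero and negative values are treated alike: what matters for records is whether the primitive is
    strictly increasing or nonincreasing. *)
Definition steady_sign h (a b : R) :=
  (forall p, a < p < b -> 0 < h p) \/ (forall p, a < p < b -> h p <= 0).

(** A continuous sign that is 1 at one point and at most 0 at another would take the value 1/2. *)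
Lemma steady_sign_of_continuous h (a b : R) :
  (forall p, a < p < b -> {for p, continuous (fun q => Num.sg (h q) : R)}) ->
  steady_sign h a b.
Proof.
move=> ch; apply: contrapT => /not_orP[/existsNP[x nx] /existsNP[y ny]].
move: nx ny => /not_implyP[axb /negP]; rewrite -leNgt => hx.
move=> /not_implyP[ayb /negP]; rewrite -ltNge => hy.
have sgx : Num.sg (h x) <= 0 by rewrite sgr_le0.
have sgy : Num.sg (h y) = 1 by exact: gtr0_sg.
have sg_half c : Num.sg (h c) <> 2^-1.
  by case: sgrP => _; lra.
have cont c d : a < c -> d < b ->
    {within `[c, d], continuous (fun q => Num.sg (h q) : R)}.
  move=> ac db; apply: continuous_in_subspaceT => z; rewrite inE/= in_itv/=.
  by move=> /andP[cz zd]; apply: ch; lra.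
move: axb ayb => /andP[ax xb] /andP[ay yb].
have [xy|/ltW yx] := leP x y.
  have [|c _] := @IVT _ _ _ _ 2^-1 xy (cont _ _ ax yb); last exact: sg_half.
  by rewrite sgy ge_min le_max; apply/andP; split; apply/orP; [left|right]; lra.
have [|c _] := @IVT _ _ _ _ 2^-1 yx (cont _ _ ay xb); last exact: sg_half.
by rewrite sgy ge_min le_max; apply/andP; split; apply/orP; [right|left]; lra.
Qed.

Lemma finite_set_gap N (p : R) : finite_set N ->
  exists2 e, 0 < e & forall x, x != p -> `|p - x| < e -> ~ N x.
Proof.
move=> fN.
have cN : closed (N `\ p).
  by apply: (accessible_finite_set_closed.1 _ _ (finite_setD _ fN));
    exact/hausdorff_accessible/norm_hausdorff.
have : nbhs p (~` (N `\ p)).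
  by apply: open_nbhs_nbhs; split; [exact: closed_openC|move=> [_]; exact].
move=> /nbhs_ballP[e /= e0 he]; exists e => // x xp pxe Nx.
by apply: (he x pxe); split => //; exact/eqP.
Qed.

Lemma steady_sign_right h (p : R) : finite_set (sign_jumps h) ->
  0 <= p < 1 -> exists2 b, p < b <= 1 & steady_sign h p b.
Proof.
move=> fh /andP[p0 p1]; have [e e0 he] := finite_set_gap p fh.
have b1 : p < Num.min (p + e) 1 <= 1 by rewrite ge_min lt_min lexx orbT; lra.
have b2 : Num.min (p + e) 1 <= p + e by rewrite ge_min lexx.
exists (Num.min (p + e) 1) => //; apply: steady_sign_of_continuous => x /andP[px xb].
apply: contrapT => nc; apply: (he x) => //; first by rewrite gt_eqF.
  by rewrite ltr0_norm; lra.
by split=> //; move: b1; lra.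
Qed.

Lemma steady_sign_left h (p : R) : finite_set (sign_jumps h) ->
  0 < p <= 1 -> exists2 a, 0 <= a < p & steady_sign h a p.
Proof.
move=> fh /andP[p0 p1]; have [e e0 he] := finite_set_gap p fh.
have b1 : 0 <= Num.max (p - e) 0 < p by rewrite le_max gt_max lexx orbT; lra.
have b2 : p - e <= Num.max (p - e) 0 by rewrite le_max lexx.
exists (Num.max (p - e) 0) => //; apply: steady_sign_of_continuous => x /andP[px xb].
apply: contrapT => nc; apply: (he x) => //; first by rewrite lt_eqF.
  by rewrite gtr0_norm; lra.
by split=> //; move: b1; lra.
Qed.

End sign_changes.

(** * Records of a primitive and their running maximum *)

Section records.
Context (R : realType).
Implicit Types (l h : R -> R) (A : set R).

Definition record_points l : set R := [set p | 0 < p <= 1 /\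
  forall q, 0 <= q < p -> l q < l p].

Definition left_eventually A (p : R) :=
  exists2 a, 0 <= a < p & forall r, a < r < p -> A r.

Lemma record_pos h (a b r s : R) : integrable01 h ->
  (forall p, a < p < b -> 0 < h p) -> a <= r -> r < s -> s <= b -> b <= 1 ->
  record_points (prim h) r -> record_points (prim h) s.
Proof.
move=> ih hpos ar rs sb b1 [/andP[r0 r1] hr].
have incr x y : r <= x -> x < y -> y <= s -> prim h x < prim h y.
  by move=> rx xy ys; apply: prim_lt => //; [lra|lra|move=> z ?; apply: hpos; lra].
split=> [|q /andP[q0 qs]]; first lra.
have [qr|rq] := ltP q r; last exact: incr.
by apply: (@lt_trans _ _ (prim h r)); [apply: hr; lra|apply: incr].
Qed.

Lemma no_record_nonpos h (a b r : R) : integrable01 h ->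
  (forall p, a < p < b -> h p <= 0) -> 0 <= a -> a < r -> r <= b ->
  ~ record_points (prim h) r.
Proof.
move=> ih hneg a0 ar rb [/andP[r0 r1] /(_ ((a + r) / 2))].
have -> : 0 <= (a + r) / 2 < r by lra.
move=> /(_ isT); rewrite ltNge => /negP; apply; apply: prim_ge => //; first lra.
  lra.
by move=> x ?; apply: hneg; lra.
Qed.

(** Just to the left of [p], either [h] is nonpositive and no record occurs, or [h] is positive and
    one record makes every later point a record. *)
Lemma record_left_dichotomy h (p : R) : integrable01 h ->
  finite_set (sign_jumps h) -> 0 < p <= 1 ->
  left_eventually (record_points (prim h)) p \/
  left_eventually (~` record_points (prim h)) p.
Proof.
move=> ih fh p01; have /andP[p0 p1] := p01.
have [a /andP[a0 ap] [hpos|hneg]] := steady_sign_left fh p01; last first.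
  right; exists a; rewrite ?a0// => r /andP[ar rp].
  by apply: (no_record_nonpos ih hneg) => //; exact: ltW.
have [[r /andP[ar rp] Ar]|nr] :=
    pselect (exists2 r, a < r < p & record_points (prim h) r).
  left; exists r => [|s /andP[rs sp]]; first lra.
  by apply: (record_pos ih hpos (ltW ar) rs (ltW sp) p1 Ar).
by right; exists a; rewrite ?a0// => r arp Ar; apply: nr; exists r.
Qed.

Lemma record_of_left_eventually h (p : R) : integrable01 h -> 0 < p <= 1 ->
  left_eventually (record_points (prim h)) p -> record_points (prim h) p.
Proof.
move=> ih p01 [a /andP[a0 ap] hA]; split=> // q /andP[q0 qp].
have /andP[p0 p1] := p01.
have m1 : a <= Num.max a q by rewrite le_max lexx.
have m2 : q <= Num.max a q by rewrite le_max lexx orbT.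
have m3 : Num.max a q < p by rewrite gt_max ap.
(* The limit at [p] only gives weak inequalities, so the strict one is secured at a record [r]
   between [q] and [p]. *)
pose r := (Num.max a q + p) / 2.
have [_ hr] : record_points (prim h) r by apply: hA; rewrite /r; lra.
apply: (@lt_le_trans _ _ (prim h r)); first by apply: hr; rewrite /r; lra.
apply: (@unit_ucont_le_left _ (fun=> prim h r) (prim h) r) => //.
- exact: unit_ucont_cst.
- exact: prim_ucont.
- by rewrite /r; lra.
- move=> s /andP[rs sp]; have [|_ hs] := hA s; first by rewrite /r in rs; lra.
  by apply/ltW/hs; rewrite /r in rs *; lra.
Qed.

Definition record_part h (p : R) : R :=
  if `[< left_eventually (record_points (prim h)) p >] then h p else 0.

Lemma record_part_left h (a b : R) : 0 <= a ->
  (forall r, a < r < b -> record_points (prim h) r) ->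
  forall r, a < r < b -> record_part h r = h r.
Proof.
move=> a0 hA r /andP[ar rb]; rewrite /record_part ifT//; apply/asboolP.
by exists a => [|s ?]; [lra|apply: hA; lra].
Qed.

Lemma record_part_left0 h (a b : R) : 0 <= a ->
  (forall r, a < r < b -> ~ record_points (prim h) r) ->
  forall r, a < r < b -> record_part h r = 0.
Proof.
move=> a0 hA r /andP[ar rb]; rewrite /record_part ifF//; apply/asboolPn.
move=> [c /andP[c0 cr] hc].
have m1 : a <= Num.max a c by rewrite le_max lexx.
have m2 : c <= Num.max a c by rewrite le_max lexx orbT.
have m3 : Num.max a c < r by rewrite gt_max ar.
by apply: (hA ((Num.max a c + r) / 2)); [lra|apply: hc; lra].
Qed.

(* The primitive of [h] restricted to the records of the primitive [l] of [h]
   is the running maximum of [l]: both start at 0, both are constant where no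
   record occurs, and both grow like [l] along an interval of records. *)
Lemma prim_record_part h (p : R) : integrable01 h ->
  integrable01 (record_part h) -> (forall q, 0 < q < 1 -> 0 <= record_part h q) ->
  finite_set (sign_jumps h) -> 0 <= p <= 1 ->
  prim h p <= prim (record_part h) p /\
  forall c, (forall q, 0 <= q <= p -> prim h q <= c) ->
    prim (record_part h) p <= c.
Proof.
move=> ih iG hG fh; set l := prim h; set G := prim (record_part h).
move: p; apply: unit_interval_real_induction => [|s /andP[s0 s1] IH|s /andP[s0 s1] IH].
- split; first by rewrite /l /G !prim0.
  by move=> c /(_ 0); rewrite /l /G !prim0 lexx; exact.
- have sle : 0 <= s <= s by rewrite s0 lexx.
  have [lGs Gs] := IH s sle.
  have lqG q : 0 <= q <= s -> l q <= G s.
    move=> /andP[q0 qs]; have [|lGq _] := IH q; first by rewrite q0.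
    by apply: (le_trans lGq); apply: prim_le => // [|x ?]; [lra|apply: hG; lra].
  have [|b /andP[sb b1] hsb] := @steady_sign_right _ h s fh; first by rewrite s0.
  (* Without records right of [s], [G] stays equal to [G s], and it only remains to keep [l] below
     that value. *)
  have noA b' : s < b' <= b -> (forall r, s < r < b' -> ~ record_points l r) ->
      (forall r, s < r < b' -> l r <= G s) ->
      exists2 b0, s < b0 & forall r, s < r < b0 -> l r <= G r /\
        forall c, (forall q, 0 <= q <= r -> l q <= c) -> G r <= c.
    move=> /andP[sb' b'b] nA lG; exists b' => // r /andP[sr rb'].
    have Gr : G r = G s.
      apply/eqP; rewrite -subr_eq0 /G (@prim_eq _ _ (cst 0) s r)//; last 1 first.
      - by move=> x ?; apply: (record_part_left0 s0 nA); lra.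
      - by rewrite /prim !Rintegral_cst//= !mul0r subrr.
      - lra.
      - lra.
      - exact: integrable0.
    rewrite Gr; split=> [|c hc]; first by apply: lG; rewrite sr.
    by apply: Gs => q /andP[q0 qs]; apply: hc; lra.
  case: hsb => [hpos|hneg]; last first.
    apply: (noA b) => [|r /andP[sr rb]|r /andP[sr rb]]; first by rewrite sb lexx.
      by apply: (no_record_nonpos ih hneg) => //; exact: ltW.
    apply: (le_trans _ lGs); apply: prim_ge => // [||x ?]; [lra|lra|].
    by apply: hneg; lra.
  (* Here [l] increases. A non-record [r0] excludes earlier records in ]s, r0[; there [l] stays
     below [G s], since a point exceeding it would be a record. *)
  have [[r0 /andP[sr0 r0b] nr0]|allA] :=
      pselect (exists2 r, s < r < b & ~ record_points l r).
    have nA r : s < r < r0 -> ~ record_points l r.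
      move=> /andP[sr rr0] Ar; apply: nr0.
      by apply: (record_pos ih hpos _ rr0 _ b1 Ar); lra.
    apply: (noA r0) => // [|r /andP[sr rr0]]; first by rewrite sr0 ltW.
    rewrite leNgt; apply/negP => lGr; apply: (nA r); first by rewrite sr.
    split=> [|q /andP[q0 qr]]; first lra.
    have [qs|sq] := leP q s; first by apply: le_lt_trans lGr; apply: lqG; rewrite q0.
    by apply: prim_lt => //; [lra|move=> x ?; apply: hpos; lra].
  have {}allA r : s < r < b -> record_points l r.
    by move=> srb; apply: contrapT => nr; apply: allA; exists r.
  (* Records arbitrarily close to the right of [s] make [l s] the maximum of [l] up to [s], by
     continuity. *)
  have Gls : G s = l s.
    apply/eqP; rewrite eq_le lGs andbT; apply: Gs => q /andP[q0 qs].
    apply: (@unit_ucont_le_right _ (fun=> l q) l s b) => //.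
    + exact: unit_ucont_cst.
    + exact: prim_ucont.
    + by rewrite sb.
    + move=> r srb; have [_ hr] := allA _ srb; apply/ltW/hr; lra.
  exists b => // r /andP[sr rb].
  have Gr : G r = l r.
    have : G r - G s = l r - l s.
      apply: prim_eq => //; [lra|lra|move=> x ?].
      by apply: (record_part_left s0 allA); lra.
    by rewrite Gls; lra.
  by rewrite Gr; split=> // c; apply; rewrite lexx andbT; lra.
- split.
    apply: (@unit_ucont_le_left _ l G 0) => //; try exact: prim_ucont.
      by rewrite lexx.
    by move=> r /andP[r0 rs]; apply: (IH r _).1; rewrite rs ltW.
  move=> c hc; apply: (@unit_ucont_le_left _ G (fun=> c) 0) => //.
  + exact: prim_ucont.
  + exact: unit_ucont_cst.
  + by rewrite lexx.
  + move=> r /andP[r0 rs]; apply: (IH r _).2; first by rewrite rs ltW.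
    by move=> q /andP[q0 qr]; apply: hc; lra.
Qed.

End records.

(** * Splicing two quantile functions *)

Section quantile_like.
Context (R : realType).
Implicit Types (f g : R -> R).
Local Notation mu := (@lebesgue_measure R).

Definition nondecreasing01 f :=
  forall x y, 0 < x -> x <= y -> y < 1 -> f x <= f y.

(** Left-continuity in order form, for nondecreasing functions: the value at [a] bounds from below
    all those between [a] and [p]. *)
Definition left_continuous01 f :=
  forall p y, 0 < p < 1 -> y < f p -> exists2 a, 0 < a < p & y < f a.

Definition quantile_like f :=
  [/\ nondecreasing01 f, left_continuous01 f & integrable01 f].

Lemma nondecreasing01_measurable f : nondecreasing01 f ->
  measurable_fun (`]0, 1[ : set R) f.
Proof.
move=> nd; have mD : measurable (`]0, 1[ : set R) by [].
apply: (measurability _ (RGenCInfty.measurableE R)) => //.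
move=> _ [_ [r ->] <-]; apply: is_interval_measurable => s t /=.
rewrite !in_itv/= !andbT => -[/andP[s0 s1] fs] [/andP[t0 t1] ft] u /andP[su ut].
have [u0 u1] : 0 < u /\ u < 1 by split; lra.
split; rewrite /= in_itv/= ?u0// andbT.
by apply: (le_trans fs); exact: nd.
Qed.

Lemma eq_integrable01 f g : (forall p, 0 < p < 1 -> f p = g p) ->
  integrable01 f -> integrable01 g.
Proof.
move=> fg; apply: eq_integrable => // x; rewrite inE/= in_itv/= => /fg.
by rewrite /comp => ->.
Qed.

Lemma integrable01D f g : integrable01 f -> integrable01 g ->
  integrable01 (f \+ g).
Proof.
move=> hf hg; rewrite /integrable01.
have -> : EFin \o (f \+ g) = ((EFin \o f) \+ (EFin \o g))%E.
  by apply/funext => x /=; rewrite EFinD.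
by apply: integrableD.
Qed.

Lemma integrable01B f g : integrable01 f -> integrable01 g ->
  integrable01 (f \- g).
Proof.
move=> hf hg; rewrite /integrable01.
have -> : EFin \o (f \- g) = ((EFin \o f) \- (EFin \o g))%E.
  by apply/funext => x /=; rewrite EFinB.
by apply: integrableB.
Qed.

Lemma integrable01_cst (c : R) : integrable01 (cst c).
Proof.
apply/integrableP; split; first exact/measurable_EFinP/measurable_cst.
rewrite [ltLHS](_ : _ = `|c|%:E)%E ?ltry//.
under eq_integral do rewrite /=.
by rewrite integral_cst//= lebesgue_measure_itv/= lte_fin ltr01 oppr0 adde0 mule1.
Qed.

(** Selecting by the records just left of [p], instead of by membership of [p], directly gives the
    left limit of the spliced function. *)
Definition splice f g (p : R) : R :=
  if `[< left_eventually (record_points (prim (g \- f))) p >] then g p else f p.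

Lemma spliceB f g p : splice f g p - f p = record_part (g \- f) p.
Proof. by rewrite /splice /record_part; case: ifP => //; rewrite subrr. Qed.

Context (f g : R -> R).
Hypotheses (qf : quantile_like f) (qg : quantile_like g).
Hypothesis fh : finite_set (sign_jumps (g \- f)).

Let ndf : nondecreasing01 f. Proof. by case: qf. Qed.
Let ndg : nondecreasing01 g. Proof. by case: qg. Qed.
Let lcf : left_continuous01 f. Proof. by case: qf. Qed.
Let lcg : left_continuous01 g. Proof. by case: qg. Qed.
Let intf : integrable01 f. Proof. by case: qf. Qed.
Let intg : integrable01 g. Proof. by case: qg. Qed.
Let ih : integrable01 (g \- f). Proof. exact: integrable01B. Qed.

Let rec := record_points (prim (g \- f)).

(** Only a switch between [x] and [y] needs an argument. If the two functions compare in the right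
    direction at some [t] in between, monotonicity chains through [t]. Otherwise [g - f] has
    constant sign on [x, y]: positive, it propagates the record [x] up to [y]; negative, it prevents
    [y] from being a record. *)
Lemma splice_nondecreasing : nondecreasing01 (splice f g).
Proof.
move=> x y x0; rewrite le_eqVlt => /predU1P[->//|xy] y1.
rewrite /splice; case: ifPn => [/asboolP Bx|/asboolPn nBx];
  case: ifPn => [/asboolP By|/asboolPn nBy]; try by [apply: ndf|apply: ndg].
- apply: ndg => //; lra.
- have [[t /andP[xt ty] ht]|hpos] :=
      pselect (exists2 t, x <= t <= y & g t <= f t).
    by apply: (le_trans (ndg x0 xt _)); [lra|apply: (le_trans ht); apply: ndf; lra].
  exfalso; apply: nBy; exists x => [|r /andP[xr ry]]; first lra.
  have Ax : rec x by apply: (record_of_left_eventually ih) => //; lra.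
  apply: (@record_pos _ (g \- f) x y x r) => //; [|exact: ltW|exact: ltW].
  move=> p ?; rewrite /= subr_gt0 ltNge; apply/negP => gfp; apply: hpos.
  by exists p => //; lra.
- have [_ Ay] : rec y by apply: (record_of_left_eventually ih) => //; lra.
  have [[t /andP[xt ty] ht]|hneg] :=
      pselect (exists2 t, x <= t <= y & f t <= g t).
    by apply: (le_trans (ndf x0 xt _)); [lra|apply: (le_trans ht); apply: ndg; lra].
  have lyx : prim (g \- f) y <= prim (g \- f) x.
    apply: prim_ge => // [|||p ?]; [exact: ltW|exact: ltW|exact: ltW|].
    rewrite /= subr_le0 leNgt; apply/negP => fgp; apply: hneg.
    by exists p; [lra|exact: ltW].
  have : 0 <= x < y by lra.
  by move=> /Ay; rewrite ltNge lyx.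
- apply: ndf => //; lra.
Qed.

(** If [g p < f p], left-continuity of [f] and monotonicity of [g] keep [g] below [f] just left of
    [p], where no record can then occur. *)
Lemma record_part_ge0 p : 0 < p < 1 -> 0 <= record_part (g \- f) p.
Proof.
move=> p01; rewrite /record_part; case: ifPn => // /asboolP[a /andP[a0 ap] hA].
rewrite /= subr_ge0 leNgt; apply/negP => gf.
have [b /andP[b0 bp] gfb] := lcf p01 gf.
have m1 : a <= Num.max a b by rewrite le_max lexx.
have m2 : b <= Num.max a b by rewrite le_max lexx orbT.
have m3 : Num.max a b < p by rewrite gt_max ap.
have Ar : rec ((Num.max a b + p) / 2) by apply: hA; lra.
apply: (@no_record_nonpos _ (g \- f) (Num.max a b) p _ ih _ _ _ _ Ar); [|lra..].
move=> x /andP[xa xp]; rewrite /= subr_le0.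
apply: (@le_trans _ _ (g p)); first by apply: ndg; lra.
by apply: (le_trans (ltW gfb)); apply: ndf; lra.
Qed.

Local Notation Q := (splice f g).

(** Left of [p] both ways of selecting follow one branch [k], either [f] or [g], so left-continuity
    and the left limit are inherited from [k]. *)
Lemma splice_left p : 0 < p < 1 -> exists a k, [/\ 0 <= a < p,
  left_continuous01 k, nondecreasing01 k, k p = Q p &
  forall r, a < r < p -> Q r = k r /\ (if r \in rec then g r else f r) = k r].
Proof.
move=> p01; have p01' : 0 < p <= 1 by lra.
have [hB|hB] := record_left_dichotomy ih fh p01'.
  have [a /andP[a0 ap] hA] := hB; exists a, g; split=> //; first by rewrite a0.
    by rewrite /splice ifT//; apply/asboolP.
  move=> r /andP[ar rp]; split; last by rewrite ifT// inE; apply: hA; rewrite ar.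
  rewrite /splice ifT//; apply/asboolP; exists a; first by rewrite a0.
  by move=> s ?; apply: hA; lra.
have [a /andP[a0 ap] hA] := hB.
have nleft r : a < r -> r <= p -> ~ left_eventually rec r.
  move=> ar rp [b /andP[b0 br] hb].
  have m1 : a <= Num.max a b by rewrite le_max lexx.
  have m2 : b <= Num.max a b by rewrite le_max lexx orbT.
  have m3 : Num.max a b < r by rewrite gt_max ar.
  by apply: (hA ((Num.max a b + r) / 2)); [lra|apply: hb; lra].
exists a, f; split=> //; first by rewrite a0.
  by rewrite /splice ifF//; apply/asboolPn; exact: nleft.
move=> r /andP[ar rp]; split; last first.
  by rewrite ifF//; apply/negP; rewrite inE; apply: hA; rewrite ar.
by rewrite /splice ifF//; apply/asboolPn; apply: nleft => //; exact: ltW.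
Qed.

Lemma splice_left_continuous : left_continuous01 Q.
Proof.
move=> p y p01; have [a [k [/andP[a0 ap] lck ndk <- hk]]] := splice_left p01.
move=> /(lck _ _ p01)[b /andP[b0 bp] yk].
have m1 : a <= Num.max a b by rewrite le_max lexx.
have m2 : b <= Num.max a b by rewrite le_max lexx orbT.
have m3 : Num.max a b < p by rewrite gt_max ap.
exists ((Num.max a b + p) / 2); first by lra.
have [|-> _] := hk ((Num.max a b + p) / 2); first lra.
by apply: (lt_le_trans yk); apply: ndk; lra.
Qed.

Lemma splice_integrable : integrable01 Q.
Proof.
have abs_int k : integrable01 k -> integrable01 (fun x => `|k x|).
  by move=> ik; exact: integrable_norm.
apply: (@le_integrable _ _ _ mu _ _ _
  (EFin \o ((fun x => `|f x|) \+ (fun x => `|g x|)))) => //.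
- have := nondecreasing01_measurable splice_nondecreasing.
  by move/measurable_EFinP; exact (fun x => x).
- move=> x _ /=; rewrite lee_fin [leRHS]ger0_norm ?addr_ge0// /splice.
  by case: ifP => _; [rewrite lerDr|rewrite lerDl].
- by apply: integrable01D; exact: abs_int.
Qed.

Lemma splice_quantile_like : quantile_like Q.
Proof.
split; [exact: splice_nondecreasing|exact: splice_left_continuous|].
exact: splice_integrable.
Qed.

Lemma record_part_integrable : integrable01 (record_part (g \- f)).
Proof.
apply: (@eq_integrable01 (Q \- f)); first by move=> p _; rewrite /= spliceB.
by apply: integrable01B => //; exact: splice_integrable.
Qed.

Lemma spliced_cvg_left p : 0 < p < 1 ->
  (if p - eps \in rec then g (p - eps) else f (p - eps))
    @[eps --> 0^'+] --> Q p.
Proof.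
move=> p01; have [a [k [/andP[a0 ap] lck ndk kp hk]]] := splice_left p01.
apply/cvgrPdist_lt => e e0.
have [|b /andP[b0 bp] kb] := lck p (k p - e) p01; first by rewrite ltrBlDr ltrDl.
near=> t.
have t0 : 0 < t by near: t; exact: nbhs_right_gt.
have ta : t < p - a by near: t; apply: nbhs_right_lt; rewrite subr_gt0.
have tb : t < p - b by near: t; apply: nbhs_right_lt; rewrite subr_gt0.
have [|_ ->] := hk (p - t); first lra.
rewrite -kp ger0_norm.
  by have : k b <= k (p - t); [apply: ndk; lra|lra].
by rewrite subr_ge0; apply: ndk; lra.
Unshelve. all: by end_near. Qed.

End quantile_like.

(** * Conjugacy of integrated quantiles and expected excesses *)

Section excess.
Context (R : realType).
Implicit Types (f g : R -> R).
Local Notation mu := (@lebesgue_measure R).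

(** The expected shortfall below [eta] of a variable with quantile function [f]. *)
Definition excess f (eta : R) : R := prim (fun x => Num.max (eta - f x) 0) 1.

Lemma prim_cst (c p : R) : 0 <= p -> prim (cst c) p = p * c.
Proof.
rewrite le_eqVlt => /predU1P[<-|p0]; first by rewrite prim0 mul0r.
rewrite /prim Rintegral_cst// mulrC; congr (_ * _).
have mup : mu `]0, p[ = p%:E.
  by rewrite lebesgue_measure_itv/= lte_fin p0 oppr0 adde0.
exact: (congr1 fine mup).
Qed.

Lemma integrable01_shift f (eta : R) : integrable01 f ->
  integrable01 (cst eta \- f).
Proof. by move=> intf; apply: integrable01B => //; exact: integrable01_cst. Qed.

Lemma integrable01_excess f (eta : R) : integrable01 f ->
  integrable01 (fun x => Num.max (eta - f x) 0).
Proof.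
by move=> intf; apply: integrable_funrpos => //; exact: integrable01_shift.
Qed.

Lemma prim_shift f (eta p : R) : integrable01 f -> 0 <= p <= 1 ->
  prim (cst eta \- f) p = p * eta - prim f p.
Proof.
move=> intf /andP[p0 p1].
by rewrite primB ?prim_cst//; exact: integrable01_cst.
Qed.

(* Young's inequality for the conjugate pair [prim f], [excess f]. *)
Lemma young_excess f (eta p : R) : integrable01 f -> 0 <= p <= 1 ->
  p * eta - prim f p <= excess f eta.
Proof.
move=> intf /[dup] p01 /andP[p0 p1]; rewrite -prim_shift//.
apply: (@le_trans _ _ (prim (fun x => Num.max (eta - f x) 0) p)).
  apply: le_Rintegral => // [||x _]; last by rewrite /= le_max lexx.
    by apply: integrable01S => //; exact: integrable01_shift.
  by apply: integrable01S => //; exact: integrable01_excess.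
apply: prim_le => // [|x _]; first exact: integrable01_excess.
by rewrite le_max lexx orbT.
Qed.

(** The positive part of [eta - f] is [eta - f] itself before the crossing and 0 after it. *)
Lemma young_excess_eq f (eta p : R) : integrable01 f -> 0 <= p <= 1 ->
  (forall x, 0 < x < p -> f x <= eta) -> (forall x, p < x < 1 -> eta <= f x) ->
  excess f eta = p * eta - prim f p.
Proof.
move=> intf /[dup] p01 /andP[p0 p1] flo fhi; rewrite -prim_shift// /excess.
have ie := integrable01_excess eta intf.
have /eqP : prim (fun x => Num.max (eta - f x) 0) 1 -
    prim (fun x => Num.max (eta - f x) 0) p = prim (cst 0) 1 - prim (cst 0) p.
  apply: prim_eq => // [|x px]; first exact: integrable01_cst.
  by apply/max_idPr; rewrite subr_le0; exact: fhi.
rewrite !prim_cst// !mulr0 subrr subr_eq0 => /eqP ->.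
apply: eq_Rintegral => x; rewrite inE/= in_itv/= => xp.
by apply/max_idPl; rewrite subr_ge0; exact: flo.
Qed.

Lemma crossing_point f (eta : R) : nondecreasing01 f -> exists2 p, 0 <= p <= 1 &
  (forall x, 0 < x < p -> f x <= eta) /\ (forall x, p < x < 1 -> eta <= f x).
Proof.
move=> ndf; pose S := [set x | x = 0 \/ 0 < x < 1 /\ f x <= eta].
have supS : has_sup S.
  by split; [exists 0; left|exists 1 => x [->//|[/andP[_ /ltW]]]].
have S0 : S 0 by left.
have p0 : 0 <= sup S by exact: sup_upper_bound.
have p1 : sup S <= 1.
  by apply: ge_sup => [|x [->//|[/andP[_ /ltW]]//]]; exists 0.
exists (sup S); first by rewrite p0.
split=> x /andP[x0 x1].
  have [y [y0|[/andP[y0 y1] fy]] xy] := sup_gt supS.1 x1; first by exfalso; lra.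
  by apply: le_trans fy; apply: ndf => //; exact: ltW.
rewrite leNgt; apply/negP => fx.
have : S x by right; split; [lra|exact: ltW].
by move=> /(sup_upper_bound supS); lra.
Qed.

(** At the point where [f] crosses [eta], Young's inequality is an equality for [f] and still a
    bound for [g]. *)
Lemma excessB_le f g (eta : R) : quantile_like f -> quantile_like g ->
  exists2 p, 0 <= p <= 1 & excess f eta - excess g eta <= prim g p - prim f p.
Proof.
move=> [ndf _ intf] [_ _ intg]; have [p p01 [flo fhi]] := crossing_point eta ndf.
exists p => //; rewrite (young_excess_eq intf p01 flo fhi).
by have := young_excess eta intg p01; lra.
Qed.

Lemma primB_le f g (c : R) : quantile_like f -> quantile_like g ->
  (forall eta, excess f eta - excess g eta <= c) ->
  forall p, 0 <= p <= 1 -> prim g p - prim f p <= c.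
Proof.
move=> [_ _ intf] [ndg _ intg] hc.
have interior p : 0 < p < 1 -> prim g p - prim f p <= c.
  move=> /andP[p0 p1]; have p01 : 0 <= p <= 1 by lra.
  (* The level [g p] is the one that [g] crosses at [p], so equality now holds for [g]. *)
  apply: le_trans (hc (g p)).
  rewrite (young_excess_eq intg p01) => [|x ?|x ?].
  - by have := young_excess (g p) intf p01; lra.
  - by apply: ndg; lra.
  - by apply: ndg; lra.
have ih : integrable01 (g \- f) by exact: integrable01B.
have {}interior p : 0 < p < 1 -> prim (g \- f) p <= c.
  by move=> p01; rewrite primB ?interior//; lra.
move=> p /andP[p0 p1]; rewrite -primB//.
(* The endpoints are reached by continuity, as [g] is monotone only inside ]0, 1[. *)
have cl := prim_ucont ih; have cc := @unit_ucont_cst R c.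
have [p_gt0|p_le0] := ltP 0 p.
  apply: (@unit_ucont_le_left _ _ (fun=> c) 0 p) => //; first by rewrite lexx.
  by move=> r ?; apply: interior; lra.
apply: (@unit_ucont_le_right _ _ (fun=> c) p 1) => //; first lra.
by move=> r ?; apply: interior; lra.
Qed.

End excess.

(** * Quantile functions of random variables *)

Section lebesgue_unit_interval.
Context (R : realType).
Local Notation mu := (@lebesgue_measure R).

Lemma lebesgue_itv01_itvNyc (c : R) : 0 <= c <= 1 ->
  mu (`]0, 1[ `&` `]-oo, c]) = c%:E.
Proof.
move=> /andP[]; rewrite le_eqVlt => /predU1P[<- _|c0].
  rewrite (_ : _ `&` _ = set0) ?measure0//; apply/seteqP; split=> // x /=.
  by rewrite !in_itv/=; lra.
rewrite le_eqVlt => /predU1P[->|c1].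
  rewrite (_ : _ `&` _ = `]0, 1[%classic).
    by rewrite lebesgue_measure_itv/= lte_fin ltr01 oppr0 adde0.
  by apply/seteqP; split=> x /=; rewrite !in_itv/=; lra.
rewrite (_ : _ `&` _ = `]0, c]%classic).
  by rewrite lebesgue_measure_itv/= lte_fin c0 oppr0 adde0.
by apply/seteqP; split=> x /=; rewrite !in_itv/=; lra.
Qed.

Lemma uniform_prob_itvoo (B : set R) : measurable B ->
  uniform_prob (@ltr01 R) B = mu (`]0, 1[ `&` B).
Proof.
move=> mB; have m01 : measurable (`]0, 1[ `&` B : set R) by exact: measurableI.
rewrite uniform_probE//; apply/eqP; rewrite eq_le; apply/andP; split.
  apply: (@le_trans _ _ (mu (`]0, 1[ `&` B `|` [set 0; 1]))).
    apply: le_measure; rewrite ?inE.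
    - exact: measurableI.
    - by apply: measurableU => //; apply: measurableU.
    - move=> x [Bx]; rewrite /= in_itv/= => /andP[x0 x1].
      have [->|nx0] := eqVneq x 0; first by right; left.
      have [->|nx1] := eqVneq x 1; first by right; right.
      left; split=> //; rewrite /= in_itv/=.
      by rewrite !lt_neqAle x0 x1 eq_sym nx0 nx1.
  have mu2 : mu [set 0; 1] = 0%E.
    by apply: countable_lebesgue_measure0; exact/finite_set_countable/finite_set2.
  have -> : mu (`]0, 1[ `&` B) =
      (mu (`]0%R, 1%R[ `&` B)%classic + mu [set 0%R; 1%R])%E.
    by rewrite mu2 adde0.
  by apply: measureU2 => //; apply: measurableU.
apply: le_measure; rewrite ?inE//; first exact: measurableI.
by move=> x [x01 Bx]; split=> //; move: x01; rewrite /= !in_itv/=; lra.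
Qed.

End lebesgue_unit_interval.

Section quantile_theory.
Context (d : measure_display) (T : measurableType d) (R : realType)
  (P : probability T R).
Implicit Types Z : {RV P >-> R}.
Local Notation mu := (@lebesgue_measure R).

Lemma cdf_fineK Z t : cdf Z t = (fine (cdf Z t))%:E.
Proof. by rewrite fineK// fin_num_measure. Qed.

Lemma fine_cdf01 Z t : 0 <= fine (cdf Z t) <= 1.
Proof. by rewrite -!lee_fin -cdf_fineK cdf_ge0 cdf_le1. Qed.

Lemma fine_cdf_nondecreasing Z s t : s <= t -> fine (cdf Z s) <= fine (cdf Z t).
Proof. by move=> st; rewrite -lee_fin -!cdf_fineK cdf_nondecreasing. Qed.

(** For [p] in ]0, 1[ the limits of the distribution function at infinity make the defining set
    non-empty and bounded below; right-continuity makes its infimum attained. *)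
Lemma quantile_galois Z p t : 0 < p < 1 ->
  (quantile Z p <= t) = (p <= fine (cdf Z t)).
Proof.
move=> /andP[p0 p1]; set F := fun t => fine (cdf Z t).
have Fnd := @fine_cdf_nondecreasing Z.
have Fy : F @ +oo --> (1 : R) by exact/fine_cvg/cvg_cdfy1.
have FNy : F @ -oo --> (0 : R) by exact/fine_cvg/cvg_cdfNy0.
have Frc a : F @ a^'+ --> F a.
  by apply: fine_cvg; rewrite -cdf_fineK; exact: cdf_right_continuous.
pose S := [set eta | p <= F eta].
have qE : quantile Z p = inf S.
  by congr inf; apply/funext => eta; rewrite /S/= cdf_fineK lee_fin.
have [b Sb] : S !=set0.
  have /filter_ex[b pb] : \forall t \near +oo, p < F t by exact: cvgr_gt Fy _ p1.
  by exists b; exact: ltW.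
have /filter_ex[a Fa] : \forall t \near -oo, F t < p by exact: cvgr_lt FNy _ p0.
have infS : has_inf S.
  split; [by exists b|exists a => x Sx]; rewrite leNgt; apply/negP => xa.
  by move: Sx Fa; rewrite /S/= => /le_trans/(_ (Fnd _ _ (ltW xa))); rewrite leNgt => /negP.
rewrite qE; apply/idP/idP => [St|St]; last by apply: ge_inf => //; exact: infS.2.
apply: (@le_trans _ _ (F (inf S))); last exact: Fnd.
rewrite leNgt; apply/negP => Fp.
have /filter_ex[x [xS Fx]] : \forall x \near (inf S)^'+, inf S < x /\ F x < p.
  near=> x; split; first by near: x; exact: nbhs_right_gt.
  by near: x; apply: cvgr_lt Fp; exact: Frc.
have [y Sy yx] := inf_lt infS.1 xS.
by move: Fx; rewrite ltNge => /negP; apply; apply: le_trans Sy _; apply/Fnd/ltW.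
Unshelve. all: by end_near. Qed.

Lemma quantile_nondecreasing Z : nondecreasing01 (quantile Z).
Proof.
move=> x y x0 xy y1; rewrite quantile_galois; last lra.
by apply: (le_trans xy); rewrite -quantile_galois//; lra.
Qed.

Lemma quantile_left_continuous Z : left_continuous01 (quantile Z).
Proof.
move=> p y p01; rewrite ltNge quantile_galois// -ltNge => Fp.
have /andP[F0 _] := fine_cdf01 Z y.
exists ((fine (cdf Z y) + p) / 2); first lra.
by rewrite ltNge quantile_galois -?ltNge; lra.
Qed.

End quantile_theory.

(** * Laws of quantile functions and of functions of a uniform variable *)

Section laws.
Context (R : realType).
Implicit Types k : R -> R.
Local Notation mu := (@lebesgue_measure R).

(** The two spaces may differ: this carries integrability between a variable and its quantile
    function on the unit interval. *)
Lemma integral_norm_eq_cdf (d d' : measure_display) (T : measurableType d)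
    (T' : measurableType d') (P : probability T R) (P' : probability T' R)
    (Z : {RV P >-> R}) (Z' : {RV P' >-> R}) : (forall t, cdf Z t = cdf Z' t) ->
  (\int[P]_w `|Z w|%:E = \int[P']_w `|Z' w|%:E)%E.
Proof.
move=> h.
have normE d1 (T1 : measurableType d1) (P1 : probability T1 R)
    (Z1 : {RV P1 >-> R}) :
    (\int[P1]_w `|Z1 w|%:E = \int[distribution P1 Z1]_x `|x|%:E)%E.
  rewrite ge0_integral_pushforward//.
  by apply/measurable_EFinP; exact: normr_measurable.
rewrite !normE; apply: eq_measure_integral => A mA _.
exact: (@probability_eq_of_itvNyc R
  (distribution P Z) (distribution P' Z') h A mA).
Qed.

(* Quantile functions are cut off outside ]0, 1[, where they take junk values. *)
Lemma restrict01_measurable k : nondecreasing01 k ->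
  measurable_fun setT (k \_ (`]0, 1[ : set R)).
Proof.
move=> /nondecreasing01_measurable mk.
by apply/(measurable_restrictT _ _).1.
Qed.

Lemma uniform_prob_preimage k t : nondecreasing01 k ->
  uniform_prob (@ltr01 R) ((k \_ `]0, 1[) @^-1` `]-oo, t]) =
  mu (`]0, 1[ `&` k @^-1` `]-oo, t]).
Proof.
move=> ndk; rewrite uniform_prob_itvoo; last first.
  rewrite -[_ @^-1` _]setTI; exact: restrict01_measurable.
congr (mu _); apply/seteqP; split=> x [x01 /=]; rewrite patchE ifT ?inE//.
Qed.

Section restricted.
Context (k : R -> R) (ndk : nondecreasing01 k).

Definition restrict01 : measurableTypeR R -> R := k \_ `]0, 1[.

Let mrestrict : measurable_fun [set: measurableTypeR R] restrict01.
Proof. exact (restrict01_measurable ndk). Qed.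

Definition restrict01_RV : {RV (uniform_prob (@ltr01 R)) >-> R} :=
  HB.pack restrict01 (@isMeasurableFun.Build _ _ _ _ restrict01 mrestrict).

Lemma integral_restrict01 :
  (\int[uniform_prob (@ltr01 R)]_x `|restrict01_RV x|%:E =
   \int[mu]_(x in `]0%R, 1%R[) `|k x|%:E)%E.
Proof.
rewrite integral_uniform//; last first.
  by apply/measurable_EFinP; exact: measurableT_comp.
rewrite subr0 invr1 mul1e.
rewrite -integral_itv_bndo_bndc; last first.
  by apply/measurable_EFinP; apply: measurable_funTS; exact: measurableT_comp.
rewrite -integral_itv_obnd_cbnd; last first.
  by apply/measurable_EFinP; apply: measurable_funTS; exact: measurableT_comp.
apply: eq_integral => x; rewrite inE/= => x01.
by rewrite /restrict01 patchE ifT// inE.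
Qed.

End restricted.

Section quantile_law.
Context (d : measure_display) (T : measurableType d) (P : probability T R).
Implicit Types Z U : {RV P >-> R}.

Lemma cdf_quantile_itv Z t :
  mu (`]0, 1[ `&` quantile Z @^-1` `]-oo, t]) = cdf Z t.
Proof.
rewrite (_ : _ `&` _ = `]0, 1[ `&` `]-oo, fine (cdf Z t)]).
  by rewrite lebesgue_itv01_itvNyc ?fine_cdf01// -cdf_fineK.
by apply/seteqP; split=> x [x01 /= qx]; split=> //;
  move: x01 qx; rewrite /= !in_itv/= => x01; rewrite quantile_galois.
Qed.

Lemma quantile_quantile_like Z : (Z : T -> R) \in Lfun P 1%E ->
  quantile_like (quantile Z).
Proof.
move=> /Lfun1_integrable/integrableP[mZ iZ].
have ndq := @quantile_nondecreasing _ _ _ _ Z.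
split=> //; first exact: quantile_left_continuous.
apply/integrableP; split.
  by have := nondecreasing01_measurable ndq; move/measurable_EFinP; exact (fun x => x).
rewrite -(integral_restrict01 ndq).
rewrite -(@integral_norm_eq_cdf _ _ _ _ P _ Z)// => t.
by rewrite -cdf_quantile_itv -uniform_prob_preimage.
Qed.

Section uniform_composition.
Context (U : {RV P >-> R}) (k : R -> R).
Hypotheses (hU : uniform01 U) (qk : quantile_like k).

Let ndk : nondecreasing01 k. Proof. by case: qk. Qed.

Let mkU : measurable_fun setT (fun w => (k \_ `]0, 1[) (U w)).
Proof.
by apply: (@measurableT_comp _ _ _ _ _ _ (k \_ `]0, 1[)) => //;
  exact: restrict01_measurable.
Qed.

Definition restrict01_comp : {RV P >-> R} :=
  HB.pack (fun w => (k \_ `]0, 1[) (U w))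
    (@isMeasurableFun.Build _ _ _ _ (fun w => (k \_ `]0, 1[) (U w)) mkU).

Lemma cdf_restrict01_comp t :
  cdf restrict01_comp t = mu (`]0, 1[ `&` k @^-1` `]-oo, t]).
Proof.
rewrite -uniform_prob_preimage// -hU//.
by rewrite -[_ @^-1` _]setTI; exact: restrict01_measurable.
Qed.

Lemma quantile_restrict01_comp p : 0 < p < 1 -> quantile restrict01_comp p = k p.
Proof.
move=> /[dup] p01 /andP[p0 p1]; have [_ lck _] := qk.
have mk t : measurable (`]0, 1[ `&` k @^-1` `]-oo, t] : set R).
  by apply: nondecreasing01_measurable.
(* If [t < k p], left-continuity gives [a < p] with [t < k a], so [k] is at most [t] on a set of
   measure at most [a]. If [k p <= t], that set contains ]0, p]. *)
rewrite /quantile (_ : [set _ | _] = `[k p, +oo[%classic) ?inf_itv//.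
apply/seteqP; split=> t /=; rewrite in_itv/= andbT cdf_restrict01_comp.
  move=> pt; rewrite leNgt; apply/negP => /(lck _ _ p01)[a /andP[a0 ap] ta].
  have : (p%:E <= a%:E)%E.
    rewrite (le_trans pt)// -(@lebesgue_itv01_itvNyc _ a); last lra.
    apply: le_measure; rewrite ?inE; [exact: mk|exact: measurableI|].
    move=> x [x01 /= kxt]; split=> //; move: x01 kxt; rewrite /= !in_itv/=.
    move=> /andP[x0 x1] kxt; rewrite leNgt; apply/negP => ax.
    by have := ndk a0 (ltW ax) x1; lra.
  by rewrite lee_fin; lra.
move=> kpt; rewrite -(@lebesgue_itv01_itvNyc _ p); last lra.
apply: le_measure; rewrite ?inE; [exact: measurableI|exact: mk|].
move=> x [x01 /= xp]; split=> //; move: x01 xp; rewrite /= !in_itv/=.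
by move=> /andP[x0 x1] xp; apply: le_trans kpt; exact: ndk.
Qed.

Lemma restrict01_comp_Lfun : (restrict01_comp : T -> R) \in Lfun P 1%E.
Proof.
apply/Lfun1_integrable/integrableP; split.
  by apply/measurable_EFinP.
rewrite /= (@integral_norm_eq_cdf _ _ _ _ P _ restrict01_comp (restrict01_RV ndk)).
  by rewrite integral_restrict01; have [_ _ /integrableP[]] := qk.
by move=> t; rewrite cdf_restrict01_comp -uniform_prob_preimage.
Qed.

End uniform_composition.

End quantile_law.

End laws.

Section tonelli.
Context (R : realType) (d : measure_display) (T : measurableType d)
  (P : probability T R).
Local Notation mu := (@lebesgue_measure R).

Let indic_eq {S1 S2 : Type} (A : set S1) (B : set S2) x y :
  (A x <-> B y) -> \1_A x = \1_B y :> R.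
Proof.
move=> AB; rewrite !indicE; congr (_%:R); congr (nat_of_bool _).
by apply/idP/idP; rewrite !inE => /AB.
Qed.

(** Tonelli for the region of pairs (t, u) with [u] in ]0, 1[ and [t] between the quantile at [u]
    and [eta]: its slice at [t <= eta] measures [cdf Z t], its slice at [u] has length
    [Num.max (eta - quantile Z u) 0]. *)
Lemma int_cdf_excess (Z : {RV P >-> R}) (eta : R) :
  (Z : T -> R) \in Lfun P 1%E ->
  int_cdf Z eta = (excess (quantile Z) eta)%:E.
Proof.
move=> /quantile_quantile_like[ndq _ intq].
have mq := restrict01_measurable ndq.
pose M := measurableTypeR R.
pose q : M -> R := quantile Z \_ `]0, 1[.
have mfst : measurable_fun [set: M * M] (fun x : M * M => x.1 : R).
  exact: measurable_fst.
have mqsnd : measurable_fun [set: M * M] (fun x : M * M => q x.2).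
  exact: (measurableT_comp (mq : measurable_fun [set: M] q) measurable_snd).
have msnd : measurable_fun [set: M * M] (fun x : M * M => x.2 : R).
  exact: measurable_snd.
pose b (x : M * M) : bool :=
  [&& (x.1 : R) <= eta, 0 < (x.2 : R), (x.2 : R) < 1 & q x.2 <= (x.1 : R)].
have mb : measurable_fun [set: M * M] b.
  apply: measurable_and; first exact: measurable_fun_ler.
  apply: measurable_and; first exact: measurable_fun_ltr.
  apply: measurable_and; first exact: measurable_fun_ltr.
  exact: measurable_fun_ler.
pose E : set (M * M) := b @^-1` [set true].
have mE : measurable E by rewrite -[E]setTI; exact: mb.
pose F (x : M * M) : \bar R := (\1_E x)%:E.
have mF : measurable_fun [set: M * M] F.
  by apply/measurable_EFinP; exact: measurable_indic.
have F0 x : (0 <= F x)%E by rewrite lee_fin.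
have := @fubini_tonelli _ _ M M R mu mu F mF F0.
have inner1 t : (\int[mu]_u F (t, u) =
    ((cdf Z) \_ `]-oo, eta]) t)%E.
  rewrite patchE; case: ifPn => [|]; rewrite ?notin_setE ?inE /= in_itv/=.
    move=> t_eta; rewrite -cdf_quantile_itv.
    pose B := `]0, 1[ `&` quantile Z @^-1` `]-oo, t].
    transitivity (\int[mu]_u (\1_B u)%:E)%E.
      apply: eq_integral => u _; congr (_%:E); apply: indic_eq.
      have qE : 0 < u < 1 -> q u = quantile Z u.
        by move=> u01; rewrite /q patchE ifT// inE/= in_itv.
      rewrite /E /b /B /=; split=> [/and4P[_ u0 u1]|[]]; rewrite !in_itv/=.
        by rewrite qE ?u0.
      by move=> /andP[u0 u1] qt; rewrite t_eta u0 u1 qE ?u0.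
    rewrite integral_indic ?setIT//.
    by apply: nondecreasing01_measurable.
  move=> /negP t_eta; apply: integral0_eq => u _; rewrite /F indicE memNset//.
  by rewrite /E/= /b (negbTE t_eta).
have inner2 u : (\int[mu]_t F (t, u) =
    ((fun u => (Num.max (eta - quantile Z u) 0)%:E) \_ `]0%R, 1%R[) u)%E.
  rewrite patchE; case: ifPn => [|]; rewrite ?notin_setE ?inE /= in_itv/=.
    move=> u01.
    transitivity (\int[mu]_t (\1_(`[quantile Z u, eta])%classic t)%:E)%E.
      apply: eq_integral => t _; congr (_%:E); apply: indic_eq.
      have qE : q u = quantile Z u by rewrite /q patchE ifT// inE/= in_itv.
      have /andP[u0 u1] := u01.
      by rewrite /E /b /= in_itv/= u0 u1 qE andbC/=.
    transitivity (mu `[quantile Z u, eta]).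
      by rewrite integral_indic// setIT.
    rewrite lebesgue_measure_itv/= lte_fin.
    case: ltP => [qe|eq_]; first by rewrite max_l// subr_ge0 ltW.
    by rewrite max_r// subr_le0.
  move=> /negP u01; apply: integral0_eq => t _; rewrite /F indicE memNset//.
  by rewrite /E/= /b => /and4P[/= _ u0 u1 _]; move: u01; rewrite u0 u1.
have e1 : (\int[mu]_t \int[mu]_u F (t, u) = int_cdf Z eta)%E.
  by rewrite /int_cdf [RHS]integral_mkcond; apply: eq_integral => x _; exact: inner1.
have e2 : (\int[mu]_u \int[mu]_t F (t, u) = (excess (quantile Z) eta)%:E)%E.
  rewrite -primE//; last exact: integrable01_excess.
  by rewrite [RHS]integral_mkcond; apply: eq_integral => x _; exact: inner2.
by rewrite e1 e2.
Qed.

End tonelli.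

(** * The projection *)

Section projection.
Context (R : realType) (d : measure_display) (T : measurableType d)
  (P : probability T R) (X Y : {RV P >-> R}).
Hypotheses (hX : (X : T -> R) \in Lfun P 1%E) (hY : (Y : T -> R) \in Lfun P 1%E).
Local Notation mu := (@lebesgue_measure R).
Local Notation f := (quantile X).
Local Notation g := (quantile Y).
Local Notation Q := (splice (quantile X) (quantile Y)).
Local Notation G := (prim (record_part (quantile Y \- quantile X))).

Let qf := quantile_quantile_like hX.
Let qg := quantile_quantile_like hY.

Lemma int_quantileE (Z : {RV P >-> R}) (p : R) :
  (Z : T -> R) \in Lfun P 1%E -> p <= 1 ->
  int_quantile Z p = (prim (quantile Z) p)%:E.
Proof. by move=> /quantile_quantile_like[_ _ intZ] p1; exact: primE. Qed.

Lemma int_quantile_gapE (p : R) : p <= 1 ->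
  int_quantile_gap X Y p = (prim (g \- f) p)%:E.
Proof.
move=> p1; have [_ _ intf] := qf; have [_ _ intg] := qg.
by rewrite /int_quantile_gap !int_quantileE// primB.
Qed.

Lemma record_setE : record_set X Y = record_points (prim (g \- f)).
Proof.
apply/seteqP; split=> p [/[dup] p01 /andP[p0 p1] hp]; split=> // q /andP[q0 qp].
  by have := hp q; rewrite q0 qp !int_quantile_gapE ?lte_fin//; [exact|lra].
by rewrite !int_quantile_gapE ?lte_fin//; [apply: hp; rewrite q0|lra].
Qed.

Lemma gap_le_excess (c : R) :
  (forall eta, (int_cdf X eta - int_cdf Y eta <= c%:E)%E) ->
  forall p, 0 <= p <= 1 -> (int_quantile_gap X Y p <= c%:E)%E.
Proof.
move=> hc p /[dup] p01 /andP[p0 p1]; have [_ _ intf] := qf; have [_ _ intg] := qg.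
rewrite int_quantile_gapE// lee_fin primB//; apply: primB_le => // eta.
by have := hc eta; rewrite !int_cdf_excess// -EFinB lee_fin.
Qed.

Lemma ereal_sup_gap_excess :
  ereal_sup [set int_quantile_gap X Y p | p in `[0, 1] : set R] =
  ereal_sup [set (int_cdf X eta - int_cdf Y eta)%E | eta in [set: R]].
Proof.
apply/eqP; rewrite eq_le; apply/andP; split.
  apply: ge_ereal_sup => _ [p + <-]; rewrite /= in_itv/= => p01.
  set s := ereal_sup _.
  have hs eta : (int_cdf X eta - int_cdf Y eta <= s)%E.
    by apply: ereal_sup_ubound; exists eta.
  case: s hs => [c hc|_|hs]; first exact: gap_le_excess.
    by rewrite leey.
  by have := hs 0; rewrite !int_cdf_excess// -EFinB leeNy_eq.
apply: ge_ereal_sup => _ [eta _ <-]; rewrite !int_cdf_excess// -EFinB.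
have [p /[dup] p01 /andP[p0 p1] hp] := excessB_le eta qf qg.
apply: (@le_trans _ _ (int_quantile_gap X Y p)).
  have [_ _ intf] := qf; have [_ _ intg] := qg.
  by rewrite int_quantile_gapE// lee_fin primB.
by apply: ereal_sup_ubound; exists p => //=; rewrite in_itv.
Qed.

(** Dominance puts the integrated quantile of [Z] above that of [Y]; subtracting that of [X] leaves
    at most the integral of the absolute difference. *)
Lemma gap_le_W1 (Z : {RV P >-> R}) : A2 Y Z ->
  exists c, W1 X Z = c%:E /\ forall p, 0 <= p <= 1 -> prim (g \- f) p <= c.
Proof.
move=> [LZ ZY]; have qZ := quantile_quantile_like LZ.
have [_ _ intf] := qf; have [_ _ intg] := qg; have [_ _ intZ] := qZ.
have iB : integrable01 (quantile Z \- f) by exact: integrable01B.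
have iN : integrable01 (fun p => `|quantile Z p - f p|) by exact: integrable_norm.
exists (prim (fun p => `|quantile Z p - f p|) 1); split; first exact: primE.
move=> p /[dup] p01 /andP[p0 p1].
apply: (@le_trans _ _ (prim (quantile Z \- f) p)).
  rewrite !primB// lerD2r -subr_le0; apply: primB_le => // eta.
  by rewrite subr_le0 -lee_fin -!int_cdf_excess.
apply: (@le_trans _ _ (prim (fun p => `|quantile Z p - f p|) p)).
  apply: le_Rintegral => // [||x _]; last exact: ler_norm.
    exact: integrable01S.
  exact: integrable01S.
by apply: prim_le.
Qed.

Hypothesis hsg : finite_set (sign_jumps (g \- f)).

Let qQ : quantile_like Q := splice_quantile_like qf qg hsg.

(** The identity holds everywhere because both sides are 0 outside ]0, 1[. *)
Lemma proj_quantileE : proj_quantile X Y = Q \_ `]0, 1[.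
Proof.
apply/funext => p; rewrite /proj_quantile patchE.
have -> : (p \in `]0, 1[%classic) = (0 < p < 1).
  by apply/idP/idP; rewrite inE/= in_itv.
case: ifPn => // p01; apply: cvg_lim => //.
have := spliced_cvg_left qf qg hsg p01.
by rewrite /spliced_quantile record_setE.
Qed.

Let gap_le_G p : 0 <= p <= 1 -> prim (g \- f) p <= G p /\
  forall c, (forall q, 0 <= q <= p -> prim (g \- f) q <= c) -> G p <= c.
Proof.
move=> p01; have [_ _ intf] := qf; have [_ _ intg] := qg.
apply: prim_record_part => //; first exact: integrable01B.
  exact: record_part_integrable.
exact: record_part_ge0.
Qed.

Lemma ereal_sup_gap :
  ereal_sup [set int_quantile_gap X Y p | p in `[0, 1] : set R] = (G 1)%:E.
Proof.
have iG := record_part_integrable qf qg.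
apply/eqP; rewrite eq_le; apply/andP; split.
  apply: ge_ereal_sup => _ [p + <-]; rewrite /= in_itv/= => /[dup] p01 /andP[p0 p1].
  rewrite int_quantile_gapE// lee_fin (le_trans (gap_le_G p01).1)//.
  apply: prim_le => // x ?; apply: record_part_ge0 => //; lra.
set s := ereal_sup _.
have hs p : 0 <= p <= 1 -> ((prim (g \- f) p)%:E <= s)%E.
  move=> /[dup] p01 /andP[p0 p1]; rewrite -int_quantile_gapE//.
  by apply: ereal_sup_ubound; exists p => //=; rewrite in_itv.
have oneP : 0 <= (1 : R) <= 1 by rewrite ler01 lexx.
case: s hs => [c hc|_|hs]; last by have := hs 1 oneP; rewrite leeNy_eq.
  by rewrite lee_fin; exact: (gap_le_G oneP).2.
by rewrite leey.
Qed.

Context (U : {RV P >-> R}) (hU : uniform01 U).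

Let Zhat := restrict01_comp U qQ.

Let qZhat p : 0 < p < 1 -> quantile Zhat p = Q p.
Proof. exact: quantile_restrict01_comp. Qed.

Lemma A2_projection : A2 Y Zhat.
Proof.
have LZ : (Zhat : T -> R) \in Lfun P 1%E by exact: restrict01_comp_Lfun.
split=> // eta; rewrite !int_cdf_excess// lee_fin -subr_le0.
(* The excess gap is bounded by a gap of integrated quantiles at one [p], which is nonpositive
   because [G] dominates the primitive of [g - f]. *)
have [p /[dup] p01 /andP[p0 p1] hp] :=
  excessB_le eta (quantile_quantile_like LZ) qg.
apply: (le_trans hp); rewrite subr_le0.
have -> : prim (quantile Zhat) p = prim Q p.
  by apply: eq_Rintegral => x; rewrite inE/= in_itv/= => ?; rewrite qZhat//; lra.
have [_ _ intf] := qf; have [_ _ intg] := qg; have [_ _ intQ] := qQ.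
have := (gap_le_G p01).1; rewrite primB//.
have -> : G p = prim Q p - prim f p.
  by rewrite -primB//; apply: eq_Rintegral => x _; rewrite /= -spliceB.
by rewrite lerD2r.
Qed.

Lemma W1_projection : W1 X Zhat = (G 1)%:E.
Proof.
rewrite -primE//; last exact: record_part_integrable.
apply: eq_integral => p; rewrite inE/= in_itv/= => p01.
by rewrite qZhat// spliceB ger0_norm//; exact: record_part_ge0.
Qed.

Lemma dist_W1_projection : dist_W1 X (A2 Y) = (G 1)%:E.
Proof.
apply/eqP; rewrite eq_le; apply/andP; split.
  rewrite -W1_projection; apply: ereal_inf_lbound.
  by exists Zhat => //; exact: A2_projection.
apply: le_ereal_inf_tmp => _ [Z AZ <-].
have [c [-> hc]] := gap_le_W1 AZ; rewrite lee_fin.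
by apply: (gap_le_G _).2 => //; lra.
Qed.

Lemma projection_spec : exists Z : {RV P >-> R},
  [/\ forall w : T, Z w = proj_quantile X Y (U w),
      A2 Y Z,
      dist_W1 X (A2 Y) = W1 X Z &
      W1 X Z =
        ereal_sup [set int_quantile_gap X Y p | p in `[0, 1] : set R]].
Proof.
exists Zhat; split; first by move=> w; rewrite proj_quantileE.
- exact: A2_projection.
- by rewrite dist_W1_projection W1_projection.
- by rewrite W1_projection ereal_sup_gap.
Qed.

End projection.


Theorem theorem5 (R : realType) (d : measure_display) (T : measurableType d)
    (P : probability T R) (X Y : {RV P >-> R})
    (hP : atomless P)
    (hX : (X : T -> R) \in Lfun P 1%E) (hY : (Y : T -> R) \in Lfun P 1%E)
    (hXY : ~ A2 Y X)
    (hsg : finite_set [set p : R | 0 < p < 1 /\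
       ~ {for p, continuous (fun q : R => Num.sg (quantile_gap X Y q) : R)}]) :
  (exists U : {RV P >-> R}, uniform01 U) /\
  forall U : {RV P >-> R}, uniform01 U ->
    exists Zhat : {RV P >-> R},
      [/\ forall w : T, Zhat w = proj_quantile X Y (U w),
          A2 Y Zhat,
          dist_W1 X (A2 Y) = W1 X Zhat,
          W1 X Zhat =
            ereal_sup [set int_quantile_gap X Y p | p in `[0, 1] : set R] &
          ereal_sup [set int_quantile_gap X Y p | p in `[0, 1] : set R] =
            ereal_sup [set (int_cdf X eta - int_cdf Y eta)%E
                      | eta in [set: R]] ].
Proof.
split=> [|U hU]; first exact: uniform01_exists.
have [Z [ZE AZ dZ WZ]] := projection_spec hX hY hsg hU.
by exists Z; split=> //; exact: ereal_sup_gap_excess.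
Qed.
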